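(* Let $n,d\geq 1$ be integers, let $V\subset\mathbb P^{n-1}(\mathbb Q_p)$ be nonempty, and let $E\subset\mathbb Q_p^n$. Suppose that for every $\omega\in V$ there is a polynomial map $$\gamma_\omega:\mathbb Q_p\to\mathbb Q_p^n,\qquad \gamma_\omega(t)=\sum_{j=0}^{d-1}a_{\omega,j}t^j+v_\omega t^d,$$ where $a_{\omega,j}\in\mathbb Q_p^n$, $v_\omega\in\mathbb Q_p^n\setminus\{0\}$ and $[v_\omega]=\omega$, such that $\gamma_\omega(\mathbb Z_p)\subset E$. Then $$\dim_{\mathrm H}E\geq\dim_{\mathrm H}V+1.$$ In particular, if $V=\mathbb P^{n-1}(\mathbb Q_p)$, then $\dim_{\mathrm H}E=n$.
   Context: $p$ is a fixed prime and $|p|_p=p^{-1}$. Cartesian powers of $\mathbb Q_p$ carry the supremum norm $\|\cdot\|$ and metric. $\dim_{\mathrm H}$ is Hausdorff dimension. $[v]$ denotes the point of projective space determined by a nonzero vector $v$. For nonzero $u,v\in\mathbb Q_p^m$, the metric on $\mathbb P^{m-1}(\mathbb Q_p)$ is $\rho([u],[v])=\max_{i,j}|u_iv_j-u_jv_i|_p/(\|u\|\,\|v\|)$. No measurability of $E$ or $V$ is assumed. *)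

(* Defs.v *)
From HB Require Import structures.
From mathcomp Require Import all_boot all_order all_algebra.
From mathcomp Require Import generic_quotient fraction zify.
From mathcomp Require Import all_classical all_reals all_analysis.

Set Implicit Arguments.
Unset Strict Implicit.
Unset Printing Implicit Defensive.

Import Order.TTheory GRing.Theory Num.Theory.
Local Open Scope classical_set_scope.
Local Open Scope ring_scope.

(* Z_p as the inverse limit of the Z/p^n: [residue x n] is the representative
   in [0, p^n) of the class of [x] modulo [p ^ n].  The primality proof is a
   parameter of the type so that the integral domain structure below can be
   attached to it. *)
Record padic_int (p : nat) (hp : prime p) := PadicInt {
  residue :> nat -> nat ;
  residue_compat : forall n, residue n = (residue n.+1 %% p ^ n)%N }.

Section PadicInt.
Variables (p : nat) (hp : prime p).
Local Notation Zp := (padic_int hp).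
Implicit Types x y z : Zp.

HB.instance Definition _ := gen_eqMixin Zp.
HB.instance Definition _ := gen_choiceMixin Zp.

Lemma pexp_gt0 n : (0 < p ^ n)%N.
Proof. by rewrite expn_gt0 prime_gt0. Qed.

Lemma padic_int_ext x y : (forall n, x n = y n) -> x = y.
Proof.
case: x y => [f hf] [g hg] /= fg; have efg : f = g by apply/funext.
by move: hg; rewrite -efg => hg; congr PadicInt; exact: Prop_irrelevance.
Qed.

Lemma residue_mod x n : (x n %% p ^ n)%N = x n.
Proof. by rewrite residue_compat modn_mod. Qed.

Lemma residue_mod_le x m n : (m <= n)%N -> (x n %% p ^ m)%N = x m.
Proof.
elim: n => [|n IH]; first by rewrite leqn0 => /eqP ->; rewrite residue_mod.
rewrite leq_eqVlt => /orP[/eqP ->|]; first exact: residue_mod.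
rewrite ltnS => mn; rewrite -(IH mn) (residue_compat x n).
by rewrite modn_dvdm// dvdn_exp2l.
Qed.

Lemma of_nats_compat (f : nat -> nat) :
  (forall n, (f n = f n.+1 %[mod p ^ n])%N) ->
  forall n, (f n %% p ^ n = (f n.+1 %% p ^ n.+1) %% p ^ n)%N.
Proof. by move=> hf n; rewrite hf modn_dvdm// dvdn_exp2l. Qed.

Definition of_nats f hf : Zp := PadicInt hp (@of_nats_compat f hf).

Fact cst_compat k n : (k = k %[mod p ^ n])%N. Proof. by []. Qed.

Fact add_compat x y n : (x n + y n = x n.+1 + y n.+1 %[mod p ^ n])%N.
Proof. by rewrite (residue_compat x n) (residue_compat y n) modnDm. Qed.

Fact mul_compat x y n : (x n * y n = x n.+1 * y n.+1 %[mod p ^ n])%N.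
Proof. by rewrite (residue_compat x n) (residue_compat y n) modnMm. Qed.

Fact opp_compat x n : ((p ^ n - x n) = (p ^ n.+1 - x n.+1) %[mod p ^ n])%N.
Proof.
have lt m : (x m < p ^ m)%N by rewrite -(residue_mod x m) ltn_pmod ?pexp_gt0.
have := lt n.+1; have := lt n; rewrite residue_compat [(p ^ n.+1)%N]expnS.
move: (p ^ n)%N (x n.+1) => q r rq rpq; apply/eqP.
rewrite -(eqn_modDr r) [X in _ == X %[mod _]]subnK ?(ltnW rpq)//.
by rewrite modnMl -(modnDmr _ r) subnK ?(ltnW rq)// modnn.
Qed.

Definition padic_int_nat k : Zp := of_nats (cst_compat k).
Definition padic_int_add x y : Zp := of_nats (add_compat x y).
Definition padic_int_opp x : Zp := of_nats (opp_compat x).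
Definition padic_int_mul x y : Zp := of_nats (mul_compat x y).

Fact padic_int_addA : associative padic_int_add.
Proof.
by move=> x y z; apply: padic_int_ext => n /=; rewrite modnDml modnDmr addnA.
Qed.

Fact padic_int_addC : commutative padic_int_add.
Proof. by move=> x y; apply: padic_int_ext => n /=; rewrite addnC. Qed.

Fact padic_int_add0 : left_id (padic_int_nat 0) padic_int_add.
Proof.
by move=> x; apply: padic_int_ext => n /=; rewrite mod0n add0n residue_mod.
Qed.

Fact padic_int_addN :
  left_inverse (padic_int_nat 0) padic_int_opp padic_int_add.
Proof.
move=> x; apply: padic_int_ext => n /=; rewrite modnDml subnK ?modnn ?mod0n//.
by rewrite ltnW// -(residue_mod x n) ltn_pmod ?pexp_gt0.
Qed.

HB.instance Definition _ := GRing.isZmodule.Build Zp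
  padic_int_addA padic_int_addC padic_int_add0 padic_int_addN.

Fact padic_int_mulA : associative padic_int_mul.
Proof.
by move=> x y z; apply: padic_int_ext => n /=; rewrite modnMml modnMmr mulnA.
Qed.

Fact padic_int_mulC : commutative padic_int_mul.
Proof. by move=> x y; apply: padic_int_ext => n /=; rewrite mulnC. Qed.

Fact padic_int_mul1 : left_id (padic_int_nat 1) padic_int_mul.
Proof.
by move=> x; apply: padic_int_ext => n /=; rewrite modnMml mul1n residue_mod.
Qed.

Fact padic_int_mulD : left_distributive padic_int_mul padic_int_add.
Proof.
move=> x y z; apply: padic_int_ext => n /=.
by rewrite modnMml modnDml modnDmr mulnDl.
Qed.

Fact padic_int_1neq0 : padic_int_nat 1 != 0.
Proof.
apply/eqP => /(congr1 (fun x : Zp => x 1%N)) /=.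
by rewrite expn1 mod0n modn_small ?prime_gt1.
Qed.

HB.instance Definition _ := GRing.Zmodule_isComNzRing.Build Zp
  padic_int_mulA padic_int_mulC padic_int_mul1 padic_int_mulD padic_int_1neq0.

Lemma residue0 n : (0 : Zp) n = 0%N. Proof. exact: mod0n. Qed.

Lemma residueM x y n : (x * y) n = (x n * y n %% p ^ n)%N. Proof. by []. Qed.

Lemma residueD x y n : (x + y) n = ((x n + y n) %% p ^ n)%N. Proof. by []. Qed.

Lemma residue_nat0 x : x 0%N = 0%N.
Proof. by rewrite -(residue_mod x 0) expn0 modn1. Qed.

Lemma residue_neq0 x : x != 0 -> exists n, x n.+1 != 0%N.
Proof.
apply: contra_neqP => /forallNP h; apply: padic_int_ext => n; rewrite residue0.
by case: n => [|n]; [exact: residue_nat0|exact/eqP/negPn/negP/h].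
Qed.

(* The largest [n] such that [p ^ n] divides [x]
   (0 by convention if [x] is 0). *)
Definition padic_int_val x : nat :=
  if pselect (exists n, x n.+1 != 0%N) is left ex then ex_minn ex else 0%N.

Lemma padic_int_valP x n : x != 0 ->
  (x n == 0%N) = (n <= padic_int_val x)%N.
Proof.
move=> /residue_neq0 x0; rewrite /padic_int_val; case: pselect => // ex.
case: ex_minnP => m xm hm; apply/idP/idP => [|nm].
  move=> /eqP xn; rewrite leqNgt; apply: contra xm => mn.
  by rewrite -(residue_mod_le x mn) xn mod0n.
case: n nm => [|n] nm; first by rewrite residue_nat0.
by apply: contraT => /hm; rewrite leqNgt nm.
Qed.

Lemma padic_int_val_unique x k : x k = 0%N -> x k.+1 != 0%N ->
  padic_int_val x = k.
Proof.
move=> xk xk1; have x0 : x != 0.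
  by apply: contraNneq xk1 => ->; rewrite residue0.
move/eqP: xk; rewrite padic_int_valP// => le1.
by move: xk1; rewrite padic_int_valP// -ltnNge ltnS => le2; apply/eqP; lia.
Qed.

Lemma residue_val x n : x != 0 -> (padic_int_val x < n)%N ->
  (0 < x n)%N /\ logn p (x n) = padic_int_val x.
Proof.
move=> x0 vn; have xn0 : (0 < x n)%N.
  by rewrite lt0n padic_int_valP// -ltnNge.
split=> //; apply/eqP; rewrite eqn_leq -ltnS ltnNge -!pfactor_dvdn//.
have dv k : (k <= n)%N -> (p ^ k %| x n)%N = (k <= padic_int_val x)%N.
  by move=> kn; rewrite -padic_int_valP// -(residue_mod_le x kn).
by rewrite !dv// ?ltnn ?leqnn// ltnW.
Qed.

Lemma padic_int_mul_val x y : x != 0 -> y != 0 ->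
  x * y != 0 /\
  padic_int_val (x * y)%R = (padic_int_val x + padic_int_val y)%N.
Proof.
move=> x0 y0; set a := padic_int_val x; set b := padic_int_val y.
have H n : (a < n)%N -> (b < n)%N ->
    forall k, (k <= n)%N -> ((x * y) k == 0%N) = (k <= a + b)%N.
  move=> an bn k kn; have [xn lx] := residue_val x0 an.
  have [yn ly] := residue_val y0 bn.
  rewrite -(residue_mod_le (x * y) kn) residueM modn_dvdm ?dvdn_exp2l//.
  by rewrite -/(dvdn _ _) pfactor_dvdn ?muln_gt0 ?xn// lognM// lx ly.
have ab : (x * y) (a + b).+1 != 0%N.
  by rewrite (H (a + b).+1) ?ltnn// ltnS ?leq_addr ?leq_addl.
split; first by apply: contraNneq ab => ->; rewrite residue0.
apply: padic_int_val_unique => //; apply/eqP.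
by rewrite (H (a + b).+1) ?leqnn// ltnS ?leq_addr ?leq_addl.
Qed.

Definition padic_int_unit : pred Zp := fun x => `[< exists y, y * x = 1 >].
Definition padic_int_inv x : Zp :=
  if pselect (exists y, y * x = 1) is left ex then projT1 (cid ex) else x.

Fact padic_int_mulV : {in padic_int_unit, left_inverse 1 padic_int_inv *%R}.
Proof.
move=> x /asboolP ux; rewrite /padic_int_inv; case: pselect => // ex.
by case: cid.
Qed.

Fact padic_int_unitP x y : y * x = 1 -> padic_int_unit x.
Proof. by move=> yx; apply/asboolP; exists y. Qed.

Fact padic_int_inv_out : {in [predC padic_int_unit], padic_int_inv =1 id}.
Proof.
move=> x /negP nux; rewrite /padic_int_inv; case: pselect => // -[y yx].
by case: nux; exact: padic_int_unitP yx.
Qed.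

HB.instance Definition _ := GRing.ComNzRing_hasMulInverse.Build Zp
  padic_int_mulV padic_int_unitP padic_int_inv_out.

Fact padic_int_idomain : GRing.integral_domain_axiom Zp.
Proof.
move=> x y xy; apply: contraT; rewrite negb_or => /andP[x0 y0].
by have [/negP] := padic_int_mul_val x0 y0; rewrite xy eqxx.
Qed.

HB.instance Definition _ :=
  GRing.ComUnitRing_isIntegral.Build Zp padic_int_idomain.

Lemma padic_int_valM x y : x != 0 -> y != 0 ->
  padic_int_val (x * y)%R = (padic_int_val x + padic_int_val y)%N.
Proof. by move=> x0 y0; case: (padic_int_mul_val x0 y0). Qed.

Lemma padic_int_valD x y : x != 0 -> y != 0 -> x + y != 0 ->
  (minn (padic_int_val x) (padic_int_val y) <= padic_int_val (x + y)%R)%N.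
Proof.
move=> x0 y0 xy0; rewrite -padic_int_valP// residueD.
have /eqP -> : x (minn (padic_int_val x) (padic_int_val y)) == 0%N.
  by rewrite padic_int_valP// geq_minl.
have /eqP -> : y (minn (padic_int_val x) (padic_int_val y)) == 0%N.
  by rewrite padic_int_valP// geq_minr.
by rewrite mod0n.
Qed.

End PadicInt.

Notation padic hp := {fraction (padic_int hp)}.
Notation "x %:F" := (@FracField.tofrac _ x) : ring_scope.

Section Padic.
Variables (R : realType) (p : nat) (hp : prime p).
Local Notation Qp := (padic hp).

(* [(repr x).1] and [(repr x).2] are a numerator and a denominator of [x]
   in Z_p; the value does not depend on the fraction (padic_abs_frac). *)
Definition padic_abs (x : Qp) : R :=
  if x == 0 then 0
  else p%:R ^ ((padic_int_val (repr x).2)%:Z - (padic_int_val (repr x).1)%:Z).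

Lemma padic_fracP (x : Qp) :
  exists a b : padic_int hp, [/\ b != 0, x = a%:F / b%:F,
    a = (repr x).1 & b = (repr x).2].
Proof.
exists (repr x).1, (repr x).2; split; [exact: denom_ratioP| |by []|by []].
apply: (canRL (mulfK _)); first by rewrite tofrac_eq0 denom_ratioP.
move: (repr x) (reprK x) => r <-; unlock FracField.tofrac.
rewrite -[LHS]FracField.pi_mul; apply/eqmodP.
rewrite /= FracField.equivfE /FracField.mulf.
by rewrite !numden_Ratio ?mulf_neq0 ?oner_eq0 ?denom_ratioP// !mulr1 mulrC.
Qed.

Let p_neq0 : p%:R != 0 :> R.
Proof. by rewrite pnatr_eq0 -lt0n prime_gt0. Qed.

Lemma padic_abs_frac (a b : padic_int hp) : a != 0 -> b != 0 ->
  padic_abs (a%:F / b%:F) =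
  p%:R ^ ((padic_int_val b)%:Z - (padic_int_val a)%:Z).
Proof.
move=> a0 b0; rewrite /padic_abs mulf_eq0 invr_eq0 !tofrac_eq0.
rewrite (negbTE a0) (negbTE b0) /=.
have [c [d [d0 e <- <-]]] := padic_fracP (a%:F / b%:F).
have e' : a * d = c * b.
  apply/eqP; rewrite -tofrac_eq !tofracM; apply/eqP.
  apply: (mulIf (_ : (b%:F)^-1 != 0)); first by rewrite invr_eq0 tofrac_eq0.
  rewrite mulfK ?tofrac_eq0// mulrAC e mulfVK ?tofrac_eq0//.
have c0 : c != 0.
  by apply: contraTneq (mulf_neq0 a0 d0) => c0; rewrite e' c0 mul0r eqxx.
have := congr1 (@padic_int_val _ _) e'; rewrite !padic_int_valM// => ev.
by congr (_ ^ _); lia.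
Qed.

Lemma padic_abs0 : padic_abs 0 = 0. Proof. by rewrite /padic_abs eqxx. Qed.

Lemma padic_abs_gt0 (x : Qp) : x != 0 -> 0 < padic_abs x.
Proof.
by move=> /negbTE x0; rewrite /padic_abs x0 exprz_gt0// ltr0n prime_gt0.
Qed.

Lemma padic_abs_ge0 (x : Qp) : 0 <= padic_abs x.
Proof.
have [->|/padic_abs_gt0/ltW//] := eqVneq x 0; by rewrite padic_abs0.
Qed.

Lemma padic_abs_eq0 (x : Qp) : (padic_abs x == 0) = (x == 0).
Proof.
have [->|x0] := eqVneq x 0; first by rewrite padic_abs0 eqxx.
by rewrite gt_eqF// padic_abs_gt0.
Qed.

Lemma padic_absM (x y : Qp) : padic_abs (x * y) = padic_abs x * padic_abs y.
Proof.
have [->|x0] := eqVneq x 0; first by rewrite mul0r padic_abs0 mul0r.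
have [->|y0] := eqVneq y 0; first by rewrite mulr0 padic_abs0 mulr0.
have [a [b [b0 ex _ _]]] := padic_fracP x.
have [c [d [d0 ey _ _]]] := padic_fracP y.
have a0 : a != 0 by apply: contraNneq x0 => a0; rewrite ex a0 tofrac0 mul0r.
have c0 : c != 0 by apply: contraNneq y0 => c0; rewrite ey c0 tofrac0 mul0r.
have -> : x * y = (a * c)%:F / (b * d)%:F.
  by rewrite ex ey !tofracM invfM mulrACA.
rewrite ex ey !padic_abs_frac ?mulf_neq0// !padic_int_valM//.
by rewrite -expfzDr//; congr (_ ^ _); lia.
Qed.

Lemma padic_absD (x y : Qp) :
  padic_abs (x + y) <= Num.max (padic_abs x) (padic_abs y).
Proof.
have [->|x0] := eqVneq x 0; first by rewrite add0r le_max lexx orbT.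
have [->|y0] := eqVneq y 0; first by rewrite addr0 le_max lexx.
have [xy|xy0] := eqVneq (x + y) 0.
  by rewrite xy padic_abs0 le_max padic_abs_ge0.
have [a [b [b0 ex _ _]]] := padic_fracP x.
have [c [d [d0 ey _ _]]] := padic_fracP y.
have a0 : a != 0 by apply: contraNneq x0 => a0; rewrite ex a0 tofrac0 mul0r.
have c0 : c != 0 by apply: contraNneq y0 => c0; rewrite ey c0 tofrac0 mul0r.
have e : x + y = (a * d + c * b)%:F / (b * d)%:F.
  by rewrite ex ey tofracD !tofracM addf_div ?tofrac_eq0.
have n0 : a * d + c * b != 0.
  by apply: contraNneq xy0 => n0; rewrite e n0 tofrac0 mul0r.
have ad0 := mulf_neq0 a0 d0; have cb0 := mulf_neq0 c0 b0.
rewrite e ex ey !padic_abs_frac ?mulf_neq0//.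
have := padic_int_valD ad0 cb0 n0; rewrite !padic_int_valM//.
have p1 : 1 < p%:R :> R by rewrite ltr1n prime_gt1.
rewrite le_max !ler_eXz2l// geq_min.
move: (padic_int_val a) (padic_int_val b) (padic_int_val c) (padic_int_val d).
move: (padic_int_val (_ + _)) => s va vb vc vd; clear=> /orP[] h.
  by apply/orP; left; lia.
by apply/orP; right; lia.
Qed.

Lemma padic_abs_p : padic_abs p%:R = p%:R^-1.
Proof.
have vp k : (p%:R : padic_int hp) k = (p %% p ^ k)%N.
  suff h m : (m%:R : padic_int hp) k = (m %% p ^ k)%N by exact: h.
  elim: m => [|m IH]; first by rewrite residue0 mod0n.
  by rewrite -natr1 residueD IH modnDm addn1.
have p1 := prime_gt1 hp.
have p20 : (p%:R : padic_int hp) 2%N != 0%N.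
  by rewrite vp modn_small -?lt0n ?prime_gt0// -{1}(expn1 p) ltn_exp2l.
have pn0 : (p%:R : padic_int hp) != 0.
  by apply: contraNneq p20 => ->; rewrite residue0.
have v1 : padic_int_val (1 : padic_int hp) = 0%N.
  apply: padic_int_val_unique; first exact: residue_nat0.
  by rewrite -[X in X != _]/(1 %% p ^ 1)%N expn1 modn_small.
have -> : (p%:R : Qp) = (p%:R : padic_int hp)%:F / 1%:F.
  by rewrite tofrac1 divr1 rmorph_nat.
rewrite padic_abs_frac ?oner_neq0// v1.
rewrite (@padic_int_val_unique _ _ _ 1%N)//; first by rewrite vp expn1 modnn.
Qed.

Definition sup_norm n (u : 'rV[Qp]_n) : R :=
  \big[Num.max/0]_(i < n) padic_abs (u 0 i).

Definition sup_dist n (u v : 'rV[Qp]_n) : R := sup_norm (u - v).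

End Padic.

Arguments padic_abs R {p hp} x.
Arguments sup_norm R {p hp n} u.
Arguments sup_dist R {p hp n} u v.

(* Points of P^(n-1)(K) are the lines of K^n. *)
Definition proj_space (K : fieldType) (n : nat) :=
  {L : {vspace 'rV[K]_n} | \dim L == 1%N}.

Fact proj_point_dim (K : fieldType) n (v : 'rV[K]_n) :
  v != 0 -> \dim <[v]>%VS == 1%N.
Proof. by move=> v0; rewrite dim_vline v0. Qed.

Definition proj_point (K : fieldType) n (v : 'rV[K]_n) (v0 : v != 0) :
  proj_space K n := exist _ <[v]>%VS (proj_point_dim v0).

Section ProjDist.
Variables (R : realType) (p : nat) (hp : prime p) (n : nat).
Local Notation Qp := (padic hp).

Definition vec_dist (u v : 'rV[Qp]_n) : R :=
  (\big[Num.max/0]_(i < n) \big[Num.max/0]_(j < n)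
     padic_abs R (u 0 i * v 0 j - u 0 j * v 0 i)) / (sup_norm R u * sup_norm R v).

(* [vpick L] is a nonzero vector of the line [L]; the value does not depend on
   the choice of representatives (proj_dist_point). *)
Definition proj_dist (x y : proj_space Qp n) : R :=
  vec_dist (vpick (val x)) (vpick (val y)).

Lemma vec_distZ (a b : Qp) (u v : 'rV[Qp]_n) : a != 0 -> b != 0 ->
  vec_dist (a *: u) (b *: v) = vec_dist u v.
Proof.
move=> a0 b0; rewrite /vec_dist.
have bigmaxM (I : finType) (c : R) (F : I -> R) : 0 <= c ->
    \big[Num.max/0]_i (c * F i) = c * \big[Num.max/0]_i F i.
  by move=> c0; elim/big_rec2: _ => [|i x y _ ->];
    rewrite ?mulr0// maxr_pMr.
have nZ (c : Qp) (w : 'rV[Qp]_n) :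
    sup_norm R (c *: w) = padic_abs R c * sup_norm R w.
  rewrite /sup_norm -bigmaxM ?padic_abs_ge0//.
  by apply: eq_bigr => i _; rewrite mxE padic_absM.
under eq_bigr => i _.
  under eq_bigr => j _.
    have -> : (a *: u) 0 i * (b *: v) 0 j - (a *: u) 0 j * (b *: v) 0 i =
        a * b * (u 0 i * v 0 j - u 0 j * v 0 i).
      by rewrite !mxE mulrBr mulrACA [in X in _ - X]mulrACA.
    rewrite padic_absM; over.
  rewrite bigmaxM ?padic_abs_ge0//; over.
rewrite bigmaxM ?padic_abs_ge0// !nZ padic_absM.
rewrite [X in _ / X]mulrACA -mulf_div divff ?mul1r//.
by rewrite mulf_neq0 ?padic_abs_eq0.
Qed.

Lemma proj_dist_point (u v : 'rV[Qp]_n) (u0 : u != 0) (v0 : v != 0) :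
  proj_dist (proj_point u0) (proj_point v0) = vec_dist u v.
Proof.
have pk (w : 'rV[Qp]_n) : w != 0 ->
    exists2 c, c != 0 & vpick <[w]>%VS = c *: w.
  move=> w0; have /vlineP[c e] := memv_pick <[w]>%VS; exists c => //.
  apply: contraNneq w0 => c0; move/eqP: e.
  by rewrite c0 scale0r vpick0 -dimv_eq0 dim_vline; case: (w =P 0).
rewrite /proj_dist /=; have [a a0 ->] := pk u u0; have [b b0 ->] := pk v v0.
exact: vec_distZ.
Qed.

End ProjDist.

Arguments proj_dist R {p hp n} x y.

Section Hausdorff.
Variables (R : realType) (T : Type) (dist : T -> T -> R).
Implicit Types (A : set T) (s delta : R).
Local Open Scope ereal_scope.

(* [-oo] on the empty set, the supremum of the distances otherwise *)
Definition diameter A : \bar R :=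
  ereal_sup [set r | exists x y, [/\ A x, A y & r = (dist x y)%:E]].

(* [diam(A)^s], with [diam(A)^0 = 1] for nonempty [A] and contribution 0 for the
   empty set, whatever [s] *)
Definition diameter_pow s A : \bar R :=
  if A == set0 then 0 else poweR (diameter A) s.

Definition delta_cover delta A : set (nat -> set T) :=
  [set U | A `<=` \bigcup_k U k /\ forall k, diameter (U k) <= delta%:E].

Definition hausdorff_premeasure s delta A : \bar R :=
  ereal_inf [set \sum_(0 <= k <oo) diameter_pow s (U k)
            | U in delta_cover delta A].

Definition hausdorff_measure s A : \bar R :=
  ereal_sup [set hausdorff_premeasure s delta A
            | delta in [set delta : R | (0 < delta)%R]].

Definition hausdorff_dim A : \bar R :=
  ereal_inf [set s%:E
            | s in [set s : R | (0 <= s)%R /\ hausdorff_measure s A = 0]].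

End Hausdorff.

Definition poly_curve (K : fieldType) (n d : nat)
    (a : 'I_d -> 'rV[K]_n) (v : 'rV[K]_n) (t : K) : 'rV[K]_n :=
  \sum_(j < d) t ^+ j *: a j + t ^+ d *: v.

(* Main.v *)
(** Modulo [p ^ k], write a curve of degree [d] as [\sum_(j < d) t ^ j * xi_j(t)]
    with [xi_j(t) = w_j + t * e_j], where [e_(d - 1)] is the leading coefficient
    and the other [e_j] are free.  The points [(t, xi)] for which the sum lies in
    [E] then contain lines in a product set of directions, and the substitution of
    [b * t] for [t], with [b = 1] modulo a power of [p], multiplies the leading
    coefficient by [b ^ d]: this gives the additional dimension.

    Such lines are counted by the polynomial method.  With [q = 1 + X] in
    [F_p[X]], the map [s |-> q ^ s] is well defined on [Z / p ^ k] modulo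
    [X ^ (p ^ k)].  If there are too few points, a dimension count gives a
    relation, with coefficients in [F_p[X]] of degree less than [p ^ k / 2] and not
    all divisible by [X], between test functions indexed by the lines; on a single
    line it becomes a polynomial in [q ^ t - 1] vanishing to high order at many
    parameters, and its reduction at [X = 0] forces the constant terms of the
    coefficients attached to that line to vanish.

    For the Hausdorff dimension, a cover of [E] with small [s]-sum gives at each
    level [k] a family of residue classes modulo [p ^ k].  By compactness of [Z_p],
    every curve has a level [k] at which at least [p ^ k / ((k + 1) * (k + 2))] of
    its parameters fall in the family, and the count above bounds the number of
    directions of the curves of level [k], hence the [t]-sum of a cover of [V] for
    every [t > s - 1]. *)
Require Import Defs.
From mathcomp Require Import all_boot all_order all_algebra zify ring boolp.
Set Implicit Arguments.
Unset Strict Implicit.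
Unset Printing Implicit Defensive.
Import Order.TTheory GRing.Theory Num.Theory.
Local Open Scope ring_scope.

(** * Orders of vanishing in [F_p[X]] *)

Section PowerOrders.
Variables (p : nat) (hp : prime p).
Local Notation F := 'F_p.
Local Notation q := (1 + 'X : {poly 'F_p}).

Lemma natF_neq0 m : coprime p m -> m%:R != 0 :> F.
Proof.
move=> pm; rewrite -(dvdn_pcharf (pchar_Fp hp)).
by rewrite prime_coprime in pm.
Qed.

(** Write [n = m * p ^ v] with [m] prime to [p]. Then [q ^ m - 1] is ['X] times a geometric sum with
    value [m] at 0, and raising to the power [p ^ v] is additive. *)
Lemma qexp_sub1 n : (0 < n)%N ->
  exists2 g : {poly F}, g.[0] != 0 & q ^+ n - 1 = 'X^(p ^ logn p n) * g.
Proof.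
move=> n0; have [m pm nE] := pfactor_coprime hp n0.
set v := logn p n in nE *.
pose g0 : {poly F} := \sum_(i < m) q ^+ i.
have g0E : q ^+ m - 1 = 'X * g0 by rewrite subrX1 addrC addKr.
exists (g0 ^+ (p ^ v)%N).
  rewrite horner_exp expf_neq0// horner_sum.
  rewrite (eq_bigr (fun=> 1)); last by move=> i _; rewrite !hornerE expr1n.
  by rewrite sumr_const card_ord natF_neq0.
have -> : q ^+ n = ('X * g0 + 1) ^+ (p ^ v)%N.
  by rewrite -g0E subrK -exprM -nE.
rewrite exprDn_pchar ?expr1n ?addrK ?exprMn//.
rewrite (eq_pnat _ (pchar_poly _)) (eq_pnat _ (pcharf_eq (pchar_Fp hp))).
by rewrite pnatX pnat_id.
Qed.

Definition ndist (m n : nat) := (m - n + (n - m))%N.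

Lemma qexp_sub m n : m != n ->
  exists2 g : {poly F}, g.[0] != 0 &
    q ^+ m - q ^+ n = 'X^(p ^ logn p (ndist m n)) * g.
Proof.
have q0 k : (q ^+ k).[0] = 1 :> F by rewrite !hornerE expr1n.
move=> mn; have [lt|le] := ltnP n m.
  have /qexp_sub1[g g0 e] : (0 < m - n)%N by rewrite subn_gt0.
  exists (q ^+ n * g); first by rewrite hornerM q0 mul1r.
  have -> : ndist m n = (m - n)%N by rewrite /ndist; lia.
  by rewrite mulrCA -e mulrBr mulr1 -exprD subnKC// ltnW.
have /qexp_sub1[g g0 e] : (0 < n - m)%N by lia.
exists (- (q ^+ m * g)).
  by rewrite hornerN hornerM q0 mul1r oppr_eq0.
have -> : ndist m n = (n - m)%N by rewrite /ndist; lia.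
by rewrite mulrN mulrCA -e mulrBr mulr1 -exprD subnKC// opprB.
Qed.

(** The term [j = logn p n] alone suffices. This trades powers for divisibility indicators, which
    can be counted after exchanging sums. *)
Lemma pow_logn_le_sum n m : ~~ (p ^ m %| n)%N ->
  (p ^ logn p n <= \sum_(j < m) p ^ j * (p ^ j %| n))%N.
Proof.
move=> h; have n0 : (0 < n)%N by case: n h => //; rewrite dvdn0.
have lt : (logn p n < m)%N by rewrite ltnNge -pfactor_dvdn.
rewrite (bigD1 (Ordinal lt))//= pfactor_dvdn// leqnn muln1.
exact: leq_addr.
Qed.

(** Once the residue modulo [p ^ j] is that of [t], the residue modulo [p ^ m] is determined by its
    quotient by [p ^ j]. *)
Lemma size_residue_class (ts : seq nat) t m j : (j <= m)%N ->
  uniq [seq s %% p ^ m | s <- ts]%N ->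
  (size [seq s <- ts | p ^ j %| ndist t s] <= p ^ (m - j))%N.
Proof.
move=> jm uts; set us := filter _ ts.
have p0 k : (0 < p ^ k)%N by rewrite expn_gt0 prime_gt0.
have dvdE s : (p ^ j %| ndist t s)%N -> (s %% p ^ j = t %% p ^ j)%N.
  rewrite /ndist; case: (leqP s t) => st.
    have -> : (t - s + (s - t) = t - s)%N by lia.
    by rewrite -eqn_mod_dvd// => /eqP ->.
  have -> : (t - s + (s - t) = s - t)%N by lia.
  by rewrite -eqn_mod_dvd ?(ltnW st)// => /eqP ->.
have mj s : (s %% p ^ m %% p ^ j = s %% p ^ j)%N.
  by rewrite modn_dvdm// dvdn_exp2l.
have uus : uniq [seq (s %% p ^ m) %/ p ^ j | s <- us]%N.
  have : uniq [seq s %% p ^ m | s <- us]%N.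
    by apply: subseq_uniq uts; apply/map_subseq/filter_subseq.
  have : all (fun s => p ^ j %| ndist t s)%N us by apply: filter_all.
  elim: us => //= s us IH /andP[hs hus] /andP[sn uus].
  rewrite IH// andbT; apply: contra sn => /mapP[s' s'us e].
  apply/mapP; exists s' => //.
  rewrite (divn_eq (s %% p ^ m)%N (p ^ j)) (divn_eq (s' %% p ^ m)%N (p ^ j)).
  by rewrite e !mj (dvdE s)// (dvdE s')// (allP hus).
rewrite -[leqLHS](size_map (fun s => (s %% p ^ m) %/ p ^ j)%N us).
rewrite -[leqRHS](size_iota 0); apply: uniq_leq_size => // x /mapP[s _ ->].
by rewrite mem_iota add0n /= ltn_divLR// -expnD subnK// ltn_pmod.
Qed.

Lemma sum_pow_logn_le (ts : seq nat) t m :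
  uniq [seq s %% p ^ m | s <- ts]%N ->
  (forall s, s \in ts -> s != t %[mod p ^ m])%N ->
  (\sum_(s <- ts) p ^ logn p (ndist t s) <= m * p ^ m)%N.
Proof.
move=> uts h.
have H s : s \in ts -> ~~ (p ^ m %| ndist t s)%N.
  move=> /h; apply: contra; rewrite /ndist.
  case: (leqP s t) => st d.
    have e : (s - t = 0)%N by lia.
    by rewrite eq_sym eqn_mod_dvd// -[(t - s)%N]addn0 -e.
  have e : (t - s = 0)%N by lia.
  by rewrite eqn_mod_dvd ?(ltnW st)// -[(s - t)%N]add0n -e.
apply: (@leq_trans (\sum_(s <- ts) \sum_(j < m) p ^ j * (p ^ j %| ndist t s))%N).
  rewrite big_seq [leqRHS]big_seq; apply: leq_sum => s /H; exact: pow_logn_le_sum.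
rewrite exchange_big /= -[X in (_ <= X * _)%N]card_ord -sum_nat_const.
apply: leq_sum => j _; rewrite -big_distrr /=.
have -> : (\sum_(s <- ts) (p ^ j %| ndist t s) =
           size [seq s <- ts | p ^ j %| ndist t s])%N.
  by rewrite size_filter -sum1_count [RHS]big_mkcond; apply: eq_bigr => s _; case: ifP.
have jm := ltnW (ltn_ord j).
have -> : (p ^ m = p ^ j * p ^ (m - j))%N by rewrite -expnD subnKC.
by rewrite leq_mul2l size_residue_class ?orbT.
Qed.

(** The orders of the factors add up. Such products are the denominators in the Lagrange
    interpolation of [vanishing_order]. *)
Lemma qexp_prod_order (ts : seq nat) t m :
  uniq [seq s %% p ^ m | s <- ts]%N ->
  (forall s, s \in ts -> s != t %[mod p ^ m])%N ->
  exists e (g : {poly F}), [/\ (e <= m * p ^ m)%N, g.[0] != 0 &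
    \prod_(s <- ts) (q ^+ t - q ^+ s) = 'X^e * g].
Proof.
move=> uts h; have := sum_pow_logn_le uts h.
have {h} : {in ts, forall s, t != s}.
  by move=> s /h; apply: contraNneq => ->.
elim: ts {uts} (m * p ^ m)%N => [|s ts IH] M h.
  by move=> _; exists 0%N, 1; rewrite big_nil hornerE oner_neq0 expr0 mulr1.
rewrite big_cons => le.
have [g1 g10 e1] := qexp_sub (h s (mem_head _ _)).
have [||e [g [le2 g0 eg]]] := IH (M - p ^ logn p (ndist t s))%N.
- by move=> s' s'ts; apply: h; rewrite inE s'ts orbT.
- by rewrite leq_subRL// (leq_trans _ le)// leq_addr.
exists (p ^ logn p (ndist t s) + e)%N, (g1 * g); split.
- by have := leq_trans (leq_addr _ _) le; lia.
- by rewrite hornerM mulf_neq0.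
by rewrite big_cons e1 eg exprD mulrACA.
Qed.

End PowerOrders.

(** * Linear relations with polynomial coefficients *)

Section Kernel.
Variable F : fieldType.

Lemma dvdXnP n (f : {poly F}) :
  reflect (forall i, (i < n)%N -> f`_i = 0) ('X^n %| f).
Proof.
apply: (iffP idP) => [/dvdpP[g ->] i lt|h]; first by rewrite coefMXn lt.
rewrite -(poly_take_drop n f).
suff -> : take_poly n f = 0 by rewrite add0r dvdp_mull.
by apply/polyP => i; rewrite coef_take_poly coef0; case: ltnP => // /h.
Qed.

(** The unknowns are the [#|J| * B] coefficients of the [c j]; there is one equation for each point
    and each power of ['X] below [K]. *)
Lemma poly_kernel (J P : finType) (B K : nat) (Phi : J -> P -> {poly F}) :
  (#|P| * K < #|J| * B)%N ->
  exists c : J -> {poly F}, [/\ (forall j, (size (c j) <= B)%N),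
    exists j, c j != 0 & forall s, 'X^K %| \sum_j c j * Phi j s].
Proof.
move=> lt; pose A := \matrix_(x < #|{: J * 'I_B}|, y < #|{: P * 'I_K}|)
  (Phi (enum_val x).1 (enum_val y).1 * 'X^((enum_val x).2))`_((enum_val y).2).
have /rowV0Pn[v /sub_kermxP vA v0] : kermx A != 0.
  rewrite kermx_eq0 -row_leq_rank -ltnNge.
  by rewrite (leq_ltn_trans (rank_leq_col _))// !card_prod !card_ord.
pose c j := \poly_(b < B)
  (if insub b is Some b' then v 0 (enum_rank (j, b' : 'I_B)) else 0).
have cE j : c j = \sum_(b < B) v 0 (enum_rank (j, b)) *: 'X^b.
  by rewrite /c poly_def; apply: eq_bigr => b _; rewrite valK.
exists c; split=> [j||s]; first exact: size_poly.
- have [x vx] : exists x, v 0 x != 0.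
    by apply/existsP; apply: contraNT v0; rewrite negb_exists => /forallP h;
      apply/eqP/rowP => x; rewrite mxE; apply/eqP; rewrite -[_ == _]negbK.
  exists (enum_val x).1; apply: contraNneq vx => c0.
  have := congr1 (fun f : {poly F} => f`_((enum_val x).2)) c0.
  by rewrite coef_poly coef0 ltn_ord valK -surjective_pairing enum_valK => ->.
apply/dvdXnP => i lt_i.
have := congr1 (fun M : 'rV_ _ => M 0 (enum_rank (s, Ordinal lt_i))) vA.
rewrite !mxE coef_sum => e; rewrite -[RHS]e.
rewrite (eq_bigr (fun j => \sum_(b < B)
  v 0 (enum_rank (j, b)) * (Phi j s * 'X^b)`_i)); last first.
  move=> j _; rewrite cE mulr_suml coef_sum; apply: eq_bigr => b _.
  by rewrite -scalerAl coefZ mulrC [_ * Phi _ _]mulrC mulrC.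
rewrite pair_big /= (reindex (@enum_val {: J * 'I_B} predT)) /=; last first.
  exact/onW_bij/enum_val_bij.
by apply: eq_bigr => x _; rewrite mxE enum_rankK /= -surjective_pairing enum_valK.
Qed.

(** The largest power of ['X] dividing all the [c j] is factored out; a nonzero [c j] bounds its
    exponent. *)
Lemma poly_primitive (J : finType) (c : J -> {poly F}) B :
  (forall j, (size (c j) <= B)%N) -> (exists j, c j != 0) ->
  exists a (c' : J -> {poly F}), [/\ (a < B)%N,
    (forall j, c j = 'X^a * c' j) & exists j, (c' j).[0] != 0].
Proof.
move=> sc [j0 cj0].
pose D a := [forall j, 'X^a %| c j].
have bnd a : D a -> (a < B)%N.
  move=> /forallP/(_ j0) /(dvdp_leq cj0); rewrite size_polyXn => le.
  by rewrite (leq_trans le).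
have exD : exists a, D a by exists 0%N; apply/forallP => j; rewrite expr0 dvd1p.
have [a /forallP Da amax] := ex_maxnP exD (fun a Da => ltnW (bnd a Da)).
exists a, (fun j => c j %/ 'X^a); split=> [||]; first exact/bnd/forallP.
  by move=> j; rewrite mulrC divpK.
apply/existsP; rewrite -[X in is_true X]negbK negb_exists.
apply/negP => /forallP h; suff /amax : D a.+1 by rewrite ltnn.
apply/forallP => j; rewrite -(divpK (Da j)) mulrC exprSr.
rewrite dvdp_mul2l ?monic_neq0 ?monicXn//.
by rewrite -[X in X %| _]subr0 -polyC0 dvdp_XsubCl /root -[_ == 0]negbK.
Qed.

End Kernel.

(** * Interpolation at the nodes [q ^ t - 1] *)

Section Interpolation.
Variables (p : nat) (hp : prime p).
Local Notation F := 'F_p.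
Local Notation q := (1 + 'X : {poly 'F_p}).
Local Notation ev0 := (horner_eval (0 : F)).

(** All nodes vanish at [X = 0], so the monic polynomial [N] with these roots reduces to
    ['X^(size ts)]. It remains to see that the remainder of [G] modulo [N] reduces to 0. *)
Lemma vanishing_order (G : {poly {poly F}}) (ts : seq nat) m K :
  uniq [seq s %% p ^ m | s <- ts]%N -> (m * p ^ m < K)%N ->
  {in ts, forall t, 'X^K %| G.[q ^+ t - 1]} ->
  'X^(size ts) %| map_poly ev0 G.
Proof.
move=> uts mK hG; pose x t : {poly F} := q ^+ t - 1.
have xB t s : x t - x s = q ^+ t - q ^+ s by rewrite /x; ring.
have uq : uniq ts by apply: map_uniq uts.
have inj_x : injective x.
  move=> t s e; apply: contraTeq isT => ts'.
  have [g g0 eg] := qexp_sub hp ts'.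
  move/eqP: e; rewrite -subr_eq0 xB eg mulf_eq0 => /orP[|/eqP g0'].
    by rewrite (negbTE (monic_neq0 (monicXn _ _))).
  by rewrite g0' horner0 eqxx in g0.
pose N : {poly {poly F}} := \prod_(t <- ts) ('X - (x t)%:P).
have Nm : N \is monic by apply: monic_prod_XsubC.
pose rho := Pdiv.Ring.rmodp G N.
have GE : G = Pdiv.Ring.rdivp G N * N + rho by apply: Pdiv.RingMonic.rdivp_eq.
have rx t : t \in ts -> rho.[x t] = G.[x t].
  move=> tts; rewrite [in RHS]GE hornerD hornerM.
  suff -> : N.[x t] = 0 by rewrite mulr0 add0r.
  apply/eqP; rewrite -/(root _ _) /N -(big_map x xpredT (fun y => 'X - y%:P)).
  by rewrite root_prod_XsubC map_f.
have szr : (size rho <= size ts)%N.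
  have := Pdiv.Ring.ltn_rmodpN0 G (monic_neq0 Nm).
  by rewrite /N size_prod_XsubC ltnS.
(* By Lagrange interpolation, the product of the units [g t] times the remainder
   [rho] is a combination of products in which all coefficients are divisible
   by [X], since the denominators vanish to order less than [K]. *)
suff r0 : map_poly ev0 rho = 0.
  rewrite GE rmorphD rmorphM /= r0 addr0 /N rmorph_prod /=.
  suff -> : \prod_(t <- ts) map_poly ev0 ('X - (x t)%:P) = 'X^(size ts).
    exact: dvdp_mull.
  rewrite (eq_bigr (fun=> 'X)); first by rewrite big_const_seq count_predT iter_mulr_1.
  move=> t _; rewrite rmorphB /= map_polyX map_polyC /= /horner_eval /x.
  by rewrite !hornerE expr1n subrr subr0.
(* For [t] in [ts]: the order of the interpolation denominator at [t], its cofactor, and the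
   quotient of the value by ['X^K]; a zero triple elsewhere. *)
have data t : {d : nat * {poly F} * {poly F} | (t \in ts) ==>
    [&& (d.1.1 < K)%N, d.1.2.[0] != 0,
      \prod_(s <- rem t ts) (x t - x s) == 'X^(d.1.1) * d.1.2 &
      rho.[x t] == 'X^K * d.2]}.
  apply: sigW; case: (boolP (t \in ts)) => [tts|_]; last by exists (0%N, 0, 0).
  have perm := perm_to_rem tts.
  have urem : uniq [seq s %% p ^ m | s <- rem t ts]%N.
    by apply: subseq_uniq uts; apply/map_subseq/rem_subseq.
  have nt s : s \in rem t ts -> (s != t %[mod p ^ m])%N.
    move=> srem; have := perm_uniq (perm_map (modn^~ (p ^ m)%N) perm).
    rewrite uts /= => /esym/andP[+ _]; apply: contra => /eqP <-.
    exact: (map_f (modn^~ (p ^ m)%N)).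
  have [e [g [le g0 eg]]] := qexp_prod_order hp urem nt.
  have /dvdpP[r er] := hG t tts.
  exists (e, g, r) => /=; rewrite (leq_ltn_trans le mK) g0 /= rx// er.
  rewrite [r * _]mulrC eqxx andbT.
  by rewrite -eg; apply/eqP; apply: eq_bigr => s _; rewrite xB.
pose e t := (sval (data t)).1.1; pose g t := (sval (data t)).1.2.
pose r t := (sval (data t)).2.
have dP t : t \in ts -> [/\ (e t < K)%N, (g t).[0] != 0,
    \prod_(s <- rem t ts) (x t - x s) = 'X^(e t) * g t &
    rho.[x t] = 'X^K * r t].
  move=> tts; rewrite /e /g /r; case: (data t) => d /=.
  by rewrite tts /= => /and4P[? ? /eqP ? /eqP ?].
pose W := \prod_(t <- ts) g t.
pose L t := ('X^(K - e t) * r t * \prod_(s <- rem t ts) g s) *: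
  \prod_(s <- rem t ts) ('X - (x s)%:P).
(* Both sides have size at most [size ts] and agree at the distinct nodes. *)
have WE : W *: rho = \sum_(t <- ts) L t.
  apply/eqP; rewrite -subr_eq0; apply/eqP.
  apply: (@roots_geq_poly_eq0 _ _ (map x ts)).
  - apply/allP => _ /mapP[t tts ->]; rewrite /root hornerD hornerN hornerZ horner_sum.
    rewrite (big_rem t)//=.
    have -> : \sum_(s <- rem t ts) (L s).[x t] = 0.
      rewrite big_seq big1// => s srem; rewrite /L hornerZ.
      suff /eqP -> : (\prod_(s0 <- rem s ts) ('X - (x s0)%:P)).[x t] == 0.
        by rewrite mulr0.
      rewrite -/(root _ _) -(big_map x xpredT (fun y => 'X - y%:P)) root_prod_XsubC.
      apply: map_f; move: srem; rewrite !mem_rem_uniq// !inE.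
      by move=> /andP[st sts]; rewrite eq_sym st tts.
    have [eK g0 eg er] := dP t tts.
    rewrite addr0 /L hornerZ.
    have -> : (\prod_(s <- rem t ts) ('X - (x s)%:P)).[x t] =
        \prod_(s <- rem t ts) (x t - x s).
      by rewrite horner_prod; apply: eq_bigr => s _; rewrite hornerXsubC.
    rewrite eg er /W (big_rem t)//= subr_eq0.
    have -> : 'X^K = 'X^(K - e t) * 'X^(e t) :> {poly F}.
      by rewrite -exprD subnK// ltnW.
    have perm5 (A : comNzRingType) (y1 y2 y3 y4 y5 : A) :
        y1 * y2 * (y3 * y4 * y5) = y3 * y5 * y2 * (y4 * y1) by ring.
    exact/eqP/perm5.
  - by rewrite map_inj_uniq.
  rewrite size_map (leq_trans (size_polyD _ _))// geq_max size_polyN.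
  rewrite (leq_trans (size_scale_leq _ _) szr) /= (leq_trans (size_sum _ _ _))//.
  apply/bigmax_leqP_seq => t tts _; rewrite (leq_trans (size_scale_leq _ _))//.
  rewrite size_prod_XsubC size_rem// prednK//.
  by case: ts tts {uts hG uq N Nm rho GE rx szr data e g r dP W L}.
(* [L t] carries the factor ['X^(K - e t)] with [e t < K] and so reduces to 0, while [W] does not
   vanish at 0. *)
have /eqP : map_poly ev0 (W *: rho) = 0.
  rewrite WE raddf_sum /= big_seq big1// => t tts; rewrite /L map_polyZ /=.
  have [eK _ _ _] := dP t tts.
  rewrite /horner_eval -subnSK// exprS -!mulrA hornerM hornerX mul0r scale0r//.
rewrite map_polyZ /= scale_poly_eq0 => /orP[|/eqP//].
rewrite /horner_eval /W horner_prod prodf_seq_eq0 => /hasP[/= t tts].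
by case: (dP t tts) => _ /negbTE ->.
Qed.

End Interpolation.

Section DvdSub.
Variables (F : fieldType) (D : {poly F}).
Implicit Types x y : {poly F}.

Lemma dvdp_bigD (I : Type) (r : seq I) (Q : pred I) (f : I -> {poly F}) :
  (forall i, Q i -> D %| f i) -> D %| \sum_(i <- r | Q i) f i.
Proof.
move=> h; elim/big_ind: _ => [|x y|//]; first exact: dvdp0.
exact: dvdp_add.
Qed.

Lemma dvdp_subM x y x' y' : D %| x - y -> D %| x' - y' -> D %| x * x' - y * y'.
Proof.
move=> h h'; have -> : x * x' - y * y' = (x - y) * x' + y * (x' - y') by ring.
exact: dvdp_add (dvdp_mulr _ h) (dvdp_mull _ h').
Qed.

Lemma dvdp_subB x y x' y' :
  D %| x - y -> D %| x' - y' -> D %| (x - x') - (y - y').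
Proof.
move=> h h'; have -> : (x - x') - (y - y') = (x - y) - (x' - y') by ring.
by rewrite dvdp_sub.
Qed.

Lemma dvdp_sub_trans x y z : D %| x - z -> D %| y - z -> D %| x - y.
Proof.
move=> h h'; have -> : x - y = (x - z) - (y - z) by ring.
by rewrite dvdp_sub.
Qed.

Lemma dvdp_subX x y n : D %| x - y -> D %| x ^+ n - y ^+ n.
Proof.
move=> h; elim: n => [|n IH]; first by rewrite !expr0 subrr dvdp0.
by rewrite !exprS dvdp_subM.
Qed.

Lemma dvdp_sub_prod (I : Type) (r : seq I) (Q : pred I) (f g : I -> {poly F}) :
  (forall i, Q i -> D %| f i - g i) ->
  D %| \prod_(i <- r | Q i) f i - \prod_(i <- r | Q i) g i.
Proof.
move=> h; elim/big_rec2: _ => [|i x y Qi IH]; first by rewrite subrr dvdp0.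
exact: dvdp_subM (h i Qi) IH.
Qed.

End DvdSub.

(** * Lines modulo a power of [p] *)

Section LinesCount.
Variables (p : nat) (hp : prime p) (h : nat) (C I : finType) (u : I -> C -> nat).
Local Notation F := 'F_p.
Local Notation q := (1 + 'X : {poly 'F_p}).
Local Notation gam := (p ^ h.-1)%N.
Local Notation J := (I * 'I_gam)%type.
Local Notation ev0 := (horner_eval (0 : F)).

Let others (w : nat) := [seq a <- iota 0 (p ^ h) | a != w %[mod p ^ h]]%N.

(** Here [x0] stands for [q] to the time and [x c] for [q] to the position. The ring is a parameter
    because the same expression is used over [F_p[X]] and over polynomials in a second variable. *)
Let test (A : comNzRingType) (j : J) (x0 : A) (x : C -> A) : A :=
  (x0 - 1) ^+ j.2 * \prod_c \prod_(a <- others (u j.1 c)) (x c - x0 ^+ a).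

Let test_morph (A B : comNzRingType) (f : {rmorphism A -> B}) j x0 x :
  f (test j x0 x) = test j (f x0) (f \o x).
Proof.
rewrite /test rmorphM rmorphXn rmorphB rmorph1 rmorph_prod; congr (_ * _).
apply: eq_bigr => c _; rewrite rmorph_prod; apply: eq_bigr => a _.
by rewrite rmorphB rmorphXn.
Qed.

Let test_dvd (D : {poly F}) j (x0 y0 : {poly F}) (x y : C -> {poly F}) :
  D %| x0 - y0 -> (forall c, D %| x c - y c) -> D %| test j x0 x - test j y0 y.
Proof.
move=> h0 hx; apply: dvdp_subM.
  by apply: dvdp_subX; apply: dvdp_subB => //; rewrite subrr dvdp0.
apply: dvdp_sub_prod => c _; apply: dvdp_sub_prod => a _.
by apply: dvdp_subB => //; apply: dvdp_subX.
Qed.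

(** The contribution of one coordinate when the test for [w] is restricted to a line of direction
    [v] and reduced at [X = 0]; the variable is then that of the line. *)
Let cross (w v : nat) := \prod_(a <- others w) (q ^+ v - q ^+ a).

Let uniq_modn n : uniq [seq s %% n | s <- iota 0 n]%N.
Proof.
rewrite map_inj_in_uniq ?iota_uniq// => x y; rewrite !mem_iota /= !add0n.
by move=> xn yn; rewrite !modn_small.
Qed.

Let own_order v : {d : nat * {poly F} |
  [&& (d.1 <= h * p ^ h)%N, d.2.[0] != 0 & cross v v == 'X^(d.1) * d.2]}.
Proof.
apply: sigW; have [||e [g [le g0 eg]]] := @qexp_prod_order p hp (others v) v h.
- by apply: subseq_uniq (uniq_modn (p ^ h)); apply/map_subseq/filter_subseq.
- by move=> s; rewrite mem_filter => /andP[].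
by exists (e, g); rewrite /= le g0 /= /cross eg.
Qed.

Let ord v := (sval (own_order v)).1.

Let cross_eq w v : (w = v %[mod p ^ h])%N -> cross w v = cross v v.
Proof. by move=> e; rewrite /cross /others e. Qed.

(** Restoring the missing factor gives a product independent of [w], through which [cross w v] is
    compared with [cross v v]. *)
Let cross_all w v : cross w v * (q ^+ v - q ^+ (w %% p ^ h)%N) =
  \prod_(a <- iota 0 (p ^ h)) (q ^+ v - q ^+ a).
Proof.
have ph : (0 < p ^ h)%N by rewrite expn_gt0 prime_gt0.
have wi : (w %% p ^ h)%N \in iota 0 (p ^ h) by rewrite mem_iota ltn_pmod.
rewrite (big_rem _ wi) /= mulrC; congr (_ * _).
rewrite /cross rem_filter ?iota_uniq// /others; congr (\prod_(a <- _) _).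
apply: eq_in_filter => a; rewrite mem_iota /= add0n => ah.
by rewrite [(a %% _)%N]modn_small.
Qed.

(* The factor at [w mod p ^ h] missing from the product has order at most
   [p ^ (h - 1)] at [v], whereas the factor at [v mod p ^ h], missing from the
   product taken for [v] itself, has order at least [p ^ h]. *)
Let cross_dvd w v : (0 < h)%N -> (w != v %[mod p ^ h])%N ->
  'X^(ord v + gam) %| cross w v.
Proof.
move=> h0 wv; have ph : (0 < p ^ h)%N by rewrite expn_gt0 prime_gt0.
have phE : (p ^ h = p * gam)%N by rewrite -expnS prednK.
rewrite /ord; case: (own_order v) => [[o g]] /= /and3P[_ g0 /eqP own].
have vw : v != (w %% p ^ h)%N.
  by apply: contraNneq wv => ->; rewrite modn_mod.
have [g1 g10 e1] := qexp_sub hp vw; set e := logn _ _ in e1.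
have e_le : (p ^ e <= gam)%N.
  rewrite leq_exp2l ?prime_gt1// -ltnS prednK// ltnNge.
  have nd0 : (0 < ndist v (w %% p ^ h))%N by rewrite /ndist; lia.
  rewrite -pfactor_dvdn//; apply: contra wv; rewrite /ndist.
  rewrite -[X in _ -> X == _]modn_mod.
  case: (leqP v (w %% p ^ h)) => st d.
    have e0 : (v - w %% p ^ h = 0)%N by lia.
    by rewrite eqn_mod_dvd// -[(_ - v)%N]add0n -e0.
  have e0 : (w %% p ^ h - v = 0)%N by lia.
  by rewrite eq_sym eqn_mod_dvd ?(ltnW st)// -[(v - _)%N]addn0 -e0.
have dv : 'X^(p ^ h) %| q ^+ v - q ^+ (v %% p ^ h)%N.
  rewrite {1}(divn_eq v (p ^ h)) addnC exprD -[X in _ - X]mulr1 -mulrBr dvdp_mull//.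
  have [-> |n0] := posnP (v %/ p ^ h)%N; first by rewrite mul0n subrr dvdp0.
  have [|g2 _ ->] := @qexp_sub1 p hp (v %/ p ^ h * p ^ h)%N.
    by rewrite muln_gt0 n0.
  rewrite dvdp_mulr// dvdp_exp2l// leq_exp2l ?prime_gt1//.
  by rewrite lognM// pfactorK// leq_addl.
have := cross_all v v; rewrite -(cross_all w) own e1 => /esym eq1.
have : 'X^o * 'X^(p ^ h) %| cross w v * ('X^(p ^ e) * g1).
  by rewrite eq1 dvdp_mul// dvdp_mulr.
have -> : 'X^o * 'X^(p ^ h) = 'X^(o + p ^ h - p ^ e) * 'X^(p ^ e) :> {poly F}.
  rewrite -!exprD subnK// (leq_trans e_le)// phE.
  by rewrite (leq_trans _ (leq_addl _ _))// leq_pmull ?prime_gt0.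
rewrite [X in _ %| X]mulrA [X in _ %| X]mulrAC dvdp_mul2r; last first.
  exact/monic_neq0/monicXn.
rewrite Gauss_dvdpl; last first.
  by rewrite coprimep_expl// coprimep_sym coprimepX.
apply: dvdp_trans; rewrite dvdp_exp2l//.
have := prime_gt1 hp; rewrite phE; move: e_le; nia.
Qed.

(** Otherwise the tests satisfy a nontrivial relation at the points of [P]. On the line of a
    coefficient not divisible by ['X], only the tests of that line survive at low order after
    reduction, and these differ by distinct powers of the variable. *)
Lemma lines_count (k m : nat) (P : finType) (b : I -> C -> nat)
    (T : I -> seq nat) (time : P -> nat) (pos : P -> C -> nat) :
  (0 < h)%N ->
  (forall i i', (forall c, u i c = u i' c %[mod p ^ h])%N -> i = i') ->
  (forall i, uniq [seq s %% p ^ m | s <- T i]%N) ->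
  (forall i, (#|C| * (h * p ^ h) + p ^ h <= size (T i))%N) ->
  (forall i t, t \in T i -> exists s, (time s = t %[mod p ^ k] /\
     forall c, pos s c = b i c + t * u i c %[mod p ^ k])%N) ->
  (2 * (m * p ^ m) < p ^ k)%N ->
  (#|I| * p ^ h.-1 <= 2 * #|P|)%N.
Proof.
move=> h0 u_inj uT sT inc mk; rewrite leqNgt; apply/negP => ltP.
(* [B] is [K / 2] rounded up: large enough for [poly_kernel], while [a < B] leaves an order [K - a]
   exceeding [m * p ^ m]. *)
set K := (p ^ k)%N in mk; pose B := (K.+1 %/ 2)%N.
have JB : (#|P| * K < #|{: J}| * B)%N.
  rewrite card_prod card_ord; set a := (#|I| * _)%N in ltP *.
  have K0 : (0 < K)%N by rewrite expn_gt0 prime_gt0.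
  have : (K <= 2 * B)%N by rewrite /B; lia.
  by nia.
have [c [sc c0 cP]] := poly_kernel (fun j s =>
  test j (q ^+ time s) (fun c => q ^+ pos s c)) JB.
have [a [c' [aB cE [j cj0]]]] := poly_primitive sc c0.
have aK : (a <= K)%N by rewrite /B in aB; lia.
pose i := j.1.
(* The relation restricted to the line [i], in the variable [q ^ t - 1]. *)
pose G : {poly {poly F}} := \sum_j (c' j) *:
  test j (1 + 'X) (fun x => (q ^+ b i x)%:P * (1 + 'X) ^+ u i x).
have periodic x y : (x = y %[mod K])%N -> 'X^K %| q ^+ x - q ^+ y.
  have aux z : 'X^K %| q ^+ z - q ^+ (z %% K)%N.
    rewrite {1}(divn_eq z K) addnC exprD -[X in _ - X]mulr1 -mulrBr dvdp_mull//.
    have [-> |n0] := posnP (z %/ K)%N; first by rewrite mul0n subrr dvdp0.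
    have [|g _ ->] := @qexp_sub1 p hp (z %/ K * K)%N.
      by rewrite muln_gt0 n0 expn_gt0 prime_gt0.
    rewrite dvdp_mulr// dvdp_exp2l// /K leq_exp2l ?prime_gt1//.
    by rewrite (lognM _ n0) ?expn_gt0 ?prime_gt0// pfactorK// leq_addl.
  by move=> e; apply: (dvdp_sub_trans (aux x)); rewrite e.
have Gt t : t \in T i -> 'X^(K - a) %| G.[q ^+ t - 1].
  move=> tT; have [s [ts ps]] := inc i t tT.
  rewrite /G horner_sum.
  have -> : \sum_j0 (c' j0 *: test j0 (1 + 'X) (fun x =>
      (q ^+ b i x)%:P * (1 + 'X) ^+ u i x)).[q ^+ t - 1] =
    \sum_j0 c' j0 * test j0 (q ^+ t) (fun x => q ^+ (b i x + t * u i x)%N).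
    apply: eq_bigr => j0 _; rewrite hornerZ; congr (_ * _).
    rewrite -/(horner_eval _ _) test_morph.
    have e1 : (1 + 'X : {poly {poly F}}).[q ^+ t - 1] = q ^+ t.
      by rewrite hornerD hornerX -polyC1 hornerC addrC subrK.
    have e2 x : ((q ^+ b i x)%:P * (1 + 'X) ^+ u i x).[q ^+ t - 1] =
        q ^+ (b i x + t * u i x)%N.
      by rewrite hornerM hornerC horner_exp e1 exprD exprM.
    by congr (test j0 _ _); [exact: e1|apply/funext => x; exact: e2].
  have := cP s; under eq_bigr do rewrite cE -mulrA.
  rewrite -mulr_sumr -{1}(subnKC aK) exprD dvdp_mul2l; last exact/monic_neq0/monicXn.
  set S1 := (X in _ %| X -> _) => d1; set S2 := (X in _ %| X).
  suff d2 : 'X^(K - a) %| S1 - S2 by rewrite -[S2](subKr S1) dvdp_sub.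
  rewrite -sumrB; apply: dvdp_bigD => j0 _.
  rewrite -mulrBr dvdp_mull//; apply: (@dvdp_trans _ 'X^K).
    by rewrite dvdp_exp2l// leq_subr.
  by apply: test_dvd => [|x]; apply: periodic.
(* [O] is the order on the line [i] of the coordinate product for direction [i]; for any other
   direction the order is at least [O + gam]. *)
pose O := (\sum_x ord (u i x))%N; pose d (j : J) := \prod_x cross (u j.1 x) (u i x).
have mKa : (m * p ^ m < K - a)%N by rewrite /B in aB; lia.
have := vanishing_order hp (uT i) mKa Gt; set H := map_poly ev0 G.
have -> : H = \sum_j0 (c' j0).[0] *: ('X^(j0.2) * d j0).
  rewrite /H /G raddf_sum; apply: eq_bigr => j0 _ /=.
  have e1 : map_poly ev0 (1 + 'X : {poly {poly F}}) = q.
    by rewrite rmorphD rmorph1 /= map_polyX.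
  have e2 x : map_poly ev0 ((q ^+ b i x)%:P * (1 + 'X) ^+ u i x) = q ^+ u i x.
    transitivity (map_poly ev0 (q ^+ b i x)%:P * map_poly ev0 (1 + 'X) ^+ u i x).
      by rewrite rmorphM; congr (_ * _); apply: rmorphXn.
    by rewrite e1 map_polyC /= /horner_eval !hornerE expr1n mul1r.
  rewrite map_polyZ /= test_morph; congr (_ *: _).
  have -> : 'X^(j0.2) * d j0 = test j0 q (fun x => q ^+ u i x).
    by rewrite /test; congr (_ ^+ _ * _); rewrite addrC addKr.
  by congr (test j0 _ _); [exact: e1|apply/funext => x; exact: e2].
have ordP x : exists2 g : {poly F}, g.[0] != 0 &
    cross (u i x) (u i x) = 'X^(ord (u i x)) * g /\ (ord (u i x) <= h * p ^ h)%N.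
  rewrite /ord; case: (own_order (u i x)) => [[o g]] /= /and3P[? ? /eqP ?].
  by exists g.
have O_le : (O + gam <= size (T i))%N.
  apply: leq_trans (sT i); apply: leq_add; last first.
    by rewrite leq_pexp2l ?prime_gt0// leq_pred.
  by rewrite -sum_nat_const; apply: leq_sum => x _; case: (ordP x) => ? _ [].
move=> /(dvdp_trans (dvdp_exp2l 'X O_le)); rewrite exprD.
pose J0 := [pred j0 : J | j0.1 == i].
have dvd_prod (f g : C -> {poly F}) (Q : pred C) : (forall x, Q x -> f x %| g x) ->
    \prod_(x | Q x) f x %| \prod_(x | Q x) g x.
  by move=> fg; elim/big_ind2: _ => // *; exact: dvdp_mul.
(* Some coordinate gains [gam] by [cross_dvd], and the others lose nothing. *)
have dd j0 : j0.1 != i -> 'X^O * 'X^gam %| d j0.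
  move=> ni; have [x ux] : exists x, (u j0.1 x != u i x %[mod p ^ h])%N.
    apply/existsP; apply: contraNT ni; rewrite negb_exists => /forallP e.
    by apply/eqP/u_inj => x; apply/eqP; rewrite -[_ == _]negbK.
  rewrite /O /d (bigD1 x)//= [in X in _ %| X](bigD1 x)//= exprD mulrAC -exprD.
  rewrite dvdp_mul ?cross_dvd// expr_sum; apply: dvd_prod => y _.
  case: (eqVneq (u j0.1 y %% p ^ h)%N (u i y %% p ^ h)%N) => [e|ne].
    by rewrite (cross_eq e); case: (ordP y) => g _ [-> _]; rewrite dvdp_mulr.
  by apply: dvdp_trans (cross_dvd h0 ne); rewrite dvdp_exp2l// leq_addr.
have [g g0 dE] : exists2 g : {poly F}, g.[0] != 0 &
    forall r : 'I_gam, d (i, r) = 'X^O * g.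
  pose gx x := cross (u i x) (u i x) %/ 'X^(ord (u i x)).
  exists (\prod_x gx x).
    rewrite horner_prod; apply/prodf_neq0 => x _; rewrite /gx.
    by case: (ordP x) => g g0 [-> _]; rewrite mulKp// monic_neq0 ?monicXn.
  move=> r; rewrite /d /O expr_sum -big_split; apply: eq_bigr => x _ /=.
  rewrite /gx; case: (ordP x) => g g0 [-> _].
  by rewrite mulKp// monic_neq0 ?monicXn.
(* Only the tests of direction [i] remain; removing ['X^O] and [g] leaves a polynomial of degree
   less than [gam] divisible by ['X^gam]. *)
rewrite (bigID J0) /= dvdp_addl; last first.
  apply: dvdp_bigD => j0 nj.
  by rewrite -mul_polyC !dvdp_mull ?dd.
have -> : \sum_(j0 : J | j0.1 == i) (c' j0).[0] *: ('X^(j0.2) * d j0) =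
    'X^O * ((\sum_(r < gam) (c' (i, r)).[0] *: 'X^r) * g).
  transitivity (\sum_(i0 | i0 == i) \sum_(r < gam)
      (c' (i0, r)).[0] *: ('X^r * d (i0, r))).
    by rewrite pair_big; apply: eq_big => -[i0 r] //=; rewrite andbT.
  rewrite big_pred1_eq mulr_suml mulr_sumr; apply: eq_bigr => r _.
  by rewrite dE -!scalerAl -!scalerAr; congr (_ *: _); rewrite mulrCA.
rewrite dvdp_mul2l; last exact/monic_neq0/monicXn.
rewrite Gauss_dvdpl; last by rewrite coprimep_expl// coprimep_sym coprimepX.
move=> /dvdXnP/(_ j.2 (ltn_ord _)); rewrite coef_sum (bigD1 j.2)//= big1.
  by rewrite addr0 coefZ coefXn eqxx mulr1 -surjective_pairing; apply/eqP.
move=> r rj; rewrite coefZ coefXn; case: eqP => [e|]; last by rewrite mulr0.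
by case/eqP: rj; apply: val_inj.
Qed.

End LinesCount.

(** * Congruences modulo powers of [p] *)

Section Congruences.
Variables (p : nat) (hp : prime p).

Lemma eqn_mod_cancel a L h x y : (0 < a)%N -> (logn p a <= L)%N ->
  (a * x = a * y %[mod p ^ h] -> x = y %[mod p ^ (h - L)])%N.
Proof.
move=> a0 aL; wlog le : x y / (x <= y)%N => [H e|/eqP].
  have [xy|yx] := leqP x y; first exact: H.
  by apply/esym/H => //; rewrite ltnW.
rewrite eq_sym eqn_mod_dvd ?leq_mul2l ?le ?orbT// -mulnBr => dv; apply/eqP.
rewrite eq_sym eqn_mod_dvd//; have [->|n0] := posnP (y - x)%N; first by rewrite dvdn0.
move: dv; rewrite !pfactor_dvdn ?muln_gt0 ?a0// lognM//; lia.
Qed.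

(** The difference of the powers is [p ^ v.+1 * (t - s)] times a sum of [d] products congruent to 1
    modulo [p ^ v.+1]. That sum has valuation exactly [v], so [2 * v + 1] digits are lost. *)
Lemma eqn_mod_expn_inj d g s t : (0 < d)%N ->
  let v := logn p d in
  ((1 + p ^ v.+1 * s) ^ d = (1 + p ^ v.+1 * t) ^ d %[mod p ^ g] ->
   s = t %[mod p ^ (g - (2 * v).+1)])%N.
Proof.
move=> d0 v; wlog le : s t / (s <= t)%N => [H e|].
  have [st|ts] := leqP s t; first exact: H.
  by apply/esym/H => //; rewrite ltnW.
set bs := (1 + _ * s)%N; set bt := (1 + _ * t)%N => /eqP.
have le_b : (bs <= bt)%N by rewrite leq_add2l leq_mul2l le orbT.
rewrite eq_sym eqn_mod_dvd ?leq_exp2r// subn_exp.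
set S := (\sum_(i < d) _)%N.
have b1 x : (1 + p ^ v.+1 * x = 1 %[mod p ^ v.+1])%N by rewrite addnC mulnC modnMDl.
have SE : (S = d %[mod p ^ v.+1])%N.
  have -> : d = (\sum_(i < d) 1)%N by rewrite sum1_card card_ord.
  rewrite /S; apply: (big_ind2 (fun x y => x = y %[mod p ^ v.+1])%N) => //.
    by move=> x1 x2 y1 y2 e1 e2; rewrite -modnDm e1 e2 modnDm.
  have bX x e : ((1 + p ^ v.+1 * x) ^ e = 1 %[mod p ^ v.+1])%N.
    by rewrite -modnXm b1 modnXm exp1n.
  by move=> i _; rewrite -modnMm !bX modnMm.
have vS : (0 < S)%N /\ logn p S = v.
  have nS : ~~ (p ^ v.+1 %| S)%N by rewrite /dvdn SE -/(dvdn _ _) pfactor_dvdn// ltnn.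
  have S0 : (0 < S)%N by rewrite lt0n; apply: contraNneq nS => ->; rewrite dvdn0.
  split=> //; apply/eqP; rewrite eqn_leq leqNgt -!pfactor_dvdn// nS /=.
  have dv k : (k <= v.+1)%N -> (p ^ k %| S)%N = (p ^ k %| d)%N.
    move=> kv; rewrite /dvdn -(modn_dvdm S (dvdn_exp2l p kv)) SE.
    by rewrite modn_dvdm// dvdn_exp2l.
  by rewrite dv// pfactor_dvdn.
have -> : (bt - bs = p ^ v.+1 * (t - s))%N by rewrite /bt /bs; nia.
case: vS => S0 lS; have p0 : (0 < p ^ v.+1)%N by rewrite expn_gt0 prime_gt0.
move=> dv; apply: (@eqn_mod_cancel (p ^ v.+1 * S) (2 * v).+1).
- by rewrite muln_gt0 p0.
- by rewrite lognM// pfactorK// lS; lia.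
apply/eqP; rewrite eq_sym eqn_mod_dvd ?leq_mul2l ?le ?orbT// -mulnBr.
by move: dv; rewrite mulnAC.
Qed.

(** Pigeonhole: a residue modulo [p ^ m] has [p ^ (k - m)] lifts, and the list keeps one element of
    [D] per residue. *)
Lemma separated_subset k m tau (D : {set 'I_(p ^ k)}) : (m <= k)%N ->
  (tau * p ^ (k - m) <= #|D|)%N ->
  exists ts : seq nat, [/\ (forall t, t \in ts -> exists2 t', t' \in D & t = t' :> nat),
    uniq [seq s %% p ^ m | s <- ts]%N & (tau <= size ts)%N].
Proof.
move=> mk le; have p0 j : (0 < p ^ j)%N by rewrite expn_gt0 prime_gt0.
pose f (t : 'I_(p ^ k)) : 'I_(p ^ m) := Ordinal (ltn_pmod t (p0 m)).
have gP (t : 'I_(p ^ k)) : (t %/ p ^ m < p ^ (k - m))%N.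
  by rewrite ltn_divLR// -expnD subnK.
pose g t := Ordinal (gP t).
have inj : injective (fun t => (f t, g t)).
  move=> t s [e1 e2]; apply: val_inj => /=.
  by rewrite (divn_eq t (p ^ m)) (divn_eq s (p ^ m)) e1 e2.
have leR : (tau <= #|f @: D|)%N.
  rewrite -(leq_pmul2r (p0 (k - m)%N)) (leq_trans le)//.
  rewrite -[X in (_ <= _ * X)%N]card_ord -cardsT -cardsX -(card_imset _ inj).
  apply/subset_leq_card/subsetP => _ /imsetP[t tD ->].
  by rewrite inE /= imset_f// inE.
have ex (r : 'I_(p ^ m)) : {t : nat | (r \in f @: D) ==>
    [exists t', (t' \in D) && (t == t' :> nat) && (f t' == r)]}.
  apply: sigW; case: imsetP => [[t tD ->]|_]; last by exists 0%N.
  by exists (val t); apply/existsP; exists t; rewrite tD !eqxx.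
have exP r : r \in f @: D -> exists t', [/\ t' \in D, sval (ex r) = t' & f t' = r].
  move=> rD; case: (ex r) => t /=; rewrite rD /= => /existsP[t'].
  by move=> /andP[/andP[? /eqP ?] /eqP ?]; exists t'.
exists [seq sval (ex r) | r <- enum (f @: D)]; split.
- move=> t /mapP[r]; rewrite mem_enum => /exP[t' [tD -> _]] ->; by exists t'.
- rewrite -map_comp (eq_in_map _ val _).1 ?map_inj_uniq ?enum_uniq//.
    exact: val_inj.
  by move=> r; rewrite mem_enum => /exP[t' [_ /= -> <-]].
by rewrite size_map -cardE.
Qed.

Lemma eqr_Zp N a b : (1 < N)%N -> (a%:R == b%:R :> 'Z_N) = (a == b %[mod N])%N.
Proof. by move=> N1; rewrite -val_eqE /= !val_Zp_nat. Qed.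

End Congruences.

(** * Curves modulo a power of [p] *)

Section CurvesCount.
Variables (p : nat) (hp : prime p) (n d k h m L : nat).
Variables (W : finType) (A : W -> nat -> 'I_n -> nat) (mu : W -> nat).
Variables (x : W -> 'I_n -> nat) (c0 : 'I_n).
Variables (Ek : {set {ffun 'I_n -> 'I_(p ^ k)}}) (T : W -> {set 'I_(p ^ k)}).

Local Notation v := (logn p d.+1).
Local Notation r0 := (L + (2 * v).+1)%N.
Local Notation tau := ((d.+1 * n) * (h * p ^ h) + p ^ h)%N.

Let point_on w (t : nat) c : nat :=
  (\sum_(j < d.+1) A w j c * t ^ j + mu w * x w c * t ^ d.+1)%N.

(** At [j = d], where [insub] fails, this is the leading coefficient of the reparametrised curve. *)
Let dir (i : W * 'I_(p ^ (h - r0)) * {ffun 'I_d * 'I_n -> 'I_(p ^ h)})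
    (j : nat) (c : 'I_n) : nat :=
  if insub j is Some j' then i.2 (j', c)
  else ((1 + p ^ v.+1 * i.1.2) ^ d.+1 * (mu i.1.1 * x i.1.1 c))%N.

(** The term [p ^ k - dir i j' c] stands for [- dir i j' c] modulo [p ^ k]; it makes the sum over
    [j] telescope. *)
Let shift (i : W * 'I_(p ^ (h - r0)) * {ffun 'I_d * 'I_n -> 'I_(p ^ h)})
    (j : nat) (c : 'I_n) : nat :=
  (A i.1.1 j c * (1 + p ^ v.+1 * i.1.2) ^ j +
   (if j is j'.+1 then p ^ k - dir i j' c else 0))%N.

Let free_coord (xi : {ffun 'I_d * 'I_n -> 'I_(p ^ k)}) (j : nat) (c : 'I_n) : nat :=
  if insub j is Some j' then xi (j', c) else 0%N.

(* [Gamma(beta t) = \sum_(j <= d) t ^ j * xi_j(t)] with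
   [xi_j(t) = shift j + t * dir j]: the coordinates [xi_1], ..., [xi_d] are free,
   and [xi_0] is recovered from them and from a point of the set containing the
   curves. *)
Lemma curves_count :
  (0 < h)%N -> (h <= k)%N -> (r0 <= h)%N -> (m <= k)%N ->
  (2 * (m * p ^ m) < p ^ k)%N ->
  (forall w, (0 < mu w)%N /\ (logn p (mu w) <= L)%N) ->
  (forall w, x w c0 = 1 %[mod p ^ k])%N ->
  (forall w w', (forall c, x w c = x w' c %[mod p ^ (h - L)])%N -> w = w') ->
  (forall w, (tau * p ^ (k - m) <= #|T w|)%N) ->
  (forall w t, t \in T w -> exists2 y, y \in Ek &
     forall c, y c = point_on w t c %[mod p ^ k])%N ->
  (#|W| * p ^ (h - r0) * p ^ (h * (d * n)) * p ^ h.-1 <=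
   2 * (p ^ k * p ^ (k * (d * n)) * #|Ek|))%N.
Proof.
move=> h0 hk r0h mk mK muP x1 x_inj T_card T_in.
have p0 j : (0 < p ^ j)%N by rewrite expn_gt0 prime_gt0.
pose I := (W * 'I_(p ^ (h - r0)) * {ffun 'I_d * 'I_n -> 'I_(p ^ h)})%type.
pose P := ('I_(p ^ k) * {ffun 'I_d * 'I_n -> 'I_(p ^ k)} * {y | y \in Ek})%type.
pose beta (i : I) := (1 + p ^ v.+1 * i.1.2)%N.
pose C := ('I_d.+1 * 'I_n)%type.
pose time (s : P) : nat := s.1.1.
(* The factor [(p ^ k).-1] is [-1] modulo [p ^ k]: coordinate 0 is the point of [Ek] minus the terms
   of positive index. *)
pose pos (s : P) (c : C) : nat :=
  if (c.1 : nat) is j.+1 then free_coord s.1.2 j c.2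
  else (val s.2 c.2 +
        (p ^ k).-1 * \sum_(j < d) time s ^ j.+1 * free_coord s.1.2 j c.2)%N.
have K1 : (1 < p ^ k)%N by rewrite -(expn0 p) ltn_exp2l ?prime_gt1// (leq_trans h0).
have v_beta (i : I) : (0 < beta i)%N /\ logn p (beta i) = 0%N.
  split=> //; apply/eqP; rewrite logn_coprime// prime_coprime// /beta expnS -mulnA.
  by rewrite dvdn_addl ?dvdn_mulr// dvdn1 neq_ltn prime_gt1// orbT.
(* [T] records parameters of the form [beta t]. As [beta] is prime to [p], pulling back to [t]
   preserves their number. *)
pose mulb (i : I) (t : 'I_(p ^ k)) : 'I_(p ^ k) :=
  Ordinal (ltn_pmod (beta i * t) (p0 k)).
have mulb_inj i : injective (mulb i).
  move=> s t [] e; apply: val_inj => /=; have [b0 vb] := v_beta i.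
  have := eqn_mod_cancel hp b0 (eq_leq vb) e.
  by rewrite subn0 !modn_small.
have D_card i : (tau * p ^ (k - m) <= #|mulb i @^-1: T i.1.1|)%N.
  by rewrite card_preimset.
pose ts i := cid (separated_subset hp mk (D_card i)).
have dirE (i : I) (j : 'I_d) c : dir i j c = i.2 (j, c) by rewrite /dir valK.
have dir_max (i : I) c :
    dir i d c = (beta i ^ d.+1 * (mu i.1.1 * x i.1.1 c))%N.
  by rewrite /dir insubF// ltnn.
(* Coordinate [c0], where [x] is 1, gives [beta ^ d.+1 * mu]. Cancelling it recovers [x] modulo
   [p ^ (h - L)], hence [w]; cancelling [mu] then recovers [beta ^ d.+1], hence the parameter of
   [beta]. *)
have dir_inj (i i' : I) :
    (forall c : C, dir i c.1 c.2 = dir i' c.1 c.2 %[mod p ^ h])%N ->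
    i = i'.
  move=> e; have ee : i.2 = i'.2.
    apply/ffunP => -[j c]; apply: val_inj => /=.
    have := e (widen_ord (leqnSn d) j, c); rewrite /= !dirE.
    by rewrite !modn_small.
  have el c : (beta i ^ d.+1 * mu i.1.1 * x i.1.1 c =
      beta i' ^ d.+1 * mu i'.1.1 * x i'.1.1 c %[mod p ^ h])%N.
    by have := e (ord_max, c); rewrite /= !dir_max !mulnA.
  have x1h w : (x w c0 = 1 %[mod p ^ h])%N.
    by rewrite -(modn_dvdm (x w c0) (dvdn_exp2l p hk)) x1 modn_dvdm ?dvdn_exp2l.
  have el0 : (beta i ^ d.+1 * mu i.1.1 = beta i' ^ d.+1 * mu i'.1.1 %[mod p ^ h])%N.
    have := el c0; rewrite -modnMmr x1h modnMmr muln1 => ->.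
    by rewrite -modnMmr x1h modnMmr muln1.
  have [b0 vb] := v_beta i; have [mu0 muL] := muP i.1.1.
  have ew : i.1.1 = i'.1.1.
    apply: x_inj => c; apply: (eqn_mod_cancel hp (a := beta i ^ d.+1 * mu i.1.1)%N).
    - by rewrite muln_gt0 expn_gt0 b0.
    - by rewrite lognM ?expn_gt0 ?b0// lognX vb muln0.
    by rewrite el -modnMml -el0 modnMml.
  have eb : (beta i ^ d.+1 = beta i' ^ d.+1 %[mod p ^ (h - L)])%N.
    apply: (eqn_mod_cancel hp mu0 muL); rewrite mulnC el0 -ew.
    by rewrite mulnC.
  have es : i.1.2 = i'.1.2.
    apply: val_inj; have := eqn_mod_expn_inj hp (ltn0Sn d) eb.
    by rewrite -subnDA !modn_small.
  by case: i i' ee ew es {e el el0 b0 vb mu0 muL eb} => [[? ?] ?] [[? ?] ?] /= -> -> ->.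
have := @lines_count p hp h C I (fun i c => dir i c.1 c.2) k m P
  (fun i c => shift i c.1 c.2) (fun i => sval (ts i)) time pos h0 dir_inj.
rewrite !card_prod !card_ord !card_ffun !card_prod !card_ord -!expnM.
have -> : #|{: {y | y \in Ek}}| = #|Ek| by rewrite card_sig; apply: eq_card.
apply=> //.
- by move=> i; rewrite /ts; case: cid => ts' [].
- by move=> i; rewrite /ts; case: cid => ts' [].
move=> i t; rewrite {1}/ts; case: cid => ts' /= [h1 _ _] /h1[t' + ->]; rewrite inE.
move=> /T_in[y yE yP]; set w := i.1.1 in yP.
exists (t', [ffun jc : 'I_d * 'I_n => Ordinal (ltn_pmod
  (shift i jc.1.+1 jc.2 + t' * dir i jc.1.+1 jc.2) (p0 k))], exist _ y yE).
split=> // -[[[|j] jd] c] /=; last first.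
  by rewrite /pos /= /free_coord insubT ffunE /= modn_mod.
apply/eqP; rewrite -eqr_Zp// /pos /=.
have NK : (p ^ k)%:R = 0 :> 'Z_(p ^ k).
  by apply/eqP; rewrite -[0]/(0%:R) eqr_Zp// modnn mod0n.
have NK1 : (p ^ k).-1%:R = -1 :> 'Z_(p ^ k).
  by rewrite -subn1 natrB ?p0// NK sub0r.
pose e j : 'Z_(p ^ k) := (dir i j c)%:R.
pose u j : 'Z_(p ^ k) := t'%:R ^+ j.+1 * e j.
pose a j : 'Z_(p ^ k) := (A w j c)%:R; pose b : 'Z_(p ^ k) := (beta i)%:R.
have yE' : (y c)%:R = \sum_(j < d.+1) a j * (b * t'%:R) ^+ j + u d :> 'Z_(p ^ k).
  transitivity ((point_on w (mulb i t') c)%:R : 'Z_(p ^ k)).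
    by apply/eqP; rewrite eqr_Zp//; apply/eqP/yP.
  have -> : u d = (mu w * x w c)%:R * (b * t'%:R) ^+ d.+1.
    by rewrite /u /e dir_max natrM natrX exprMn -/b; ring.
  have bt : (mulb i t' : nat)%:R = b * t'%:R :> 'Z_(p ^ k).
    by rewrite -natrM; apply/eqP; rewrite eqr_Zp// modn_mod.
  rewrite /point_on natrD natr_sum natrM natrX bt; congr (_ + _).
  by apply: eq_bigr => j _; rewrite natrM natrX bt.
have -> : shift i 0 c = A w 0 c by rewrite /shift /= addn0 muln1.
rewrite natrD natrM NK1 natr_sum yE' big_ord_recl expr0 mulr1 natrD natrM.
have -> : \sum_(j < d) (t' ^ j.+1 * free_coord
    [ffun jc : 'I_d * 'I_n => Ordinal (ltn_pmod
      (shift i jc.1.+1 jc.2 + t' * dir i jc.1.+1 jc.2) (p0 k))] j c)%:R =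
    \sum_(j < d) a (lift ord0 j) * (b * t'%:R) ^+ (lift ord0 j) +
    \sum_(j < d) (u j.+1 - u j) :> 'Z_(p ^ k).
  rewrite -big_split; apply: eq_bigr => j _ /=; rewrite natrM natrX.
  have -> : (free_coord [ffun jc : 'I_d * 'I_n => Ordinal (ltn_pmod
      (shift i jc.1.+1 jc.2 + t' * dir i jc.1.+1 jc.2) (p0 k))] j c)%:R =
      a j.+1 * b ^+ j.+1 - e j + t'%:R * e j.+1 :> 'Z_(p ^ k).
    transitivity ((shift i j.+1 c + t' * dir i j.+1 c)%:R : 'Z_(p ^ k)).
      by apply/eqP; rewrite eqr_Zp// /free_coord valK ffunE /= modn_mod.
    rewrite /shift !natrD !natrM natrX natrB ?NK ?sub0r//.
    by rewrite dirE (leq_trans (ltnW (ltn_ord _)))// leq_pexp2l ?prime_gt0.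
  by rewrite /u /bump /= add1n exprMn [t'%:R ^+ j.+2]exprS; ring.
(* The sum telescopes to [u d - u 0], so that [a 0 + u 0 = a 0 + t' * e 0] remains. *)
rewrite -(big_mkord xpredT (fun j => u j.+1 - u j)) telescope_sumr//.
apply/eqP; rewrite -/(e 0%N) -/(a 0%N) /u expr1; ring.
Qed.

End CurvesCount.

From mathcomp Require Import all_solvable fraction lra.
From mathcomp Require Import all_classical all_reals all_analysis.
Local Open Scope classical_set_scope.
Local Open Scope ring_scope.

(** * The [p]-adic numbers and covers by residue classes *)

Section PadicInt.
Variables (p : nat) (hp : prime p).
Local Notation Zp := (padic_int hp).
Implicit Types x y z : Zp.

Lemma residue_natr m k : (m%:R : Zp) k = (m %% p ^ k)%N.
Proof.
elim: m => [|m IH]; first by rewrite residue0 mod0n.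
by rewrite -natr1 residueD IH modnDm addn1.
Qed.

Lemma residueX x m k : (x ^+ m) k = (x k ^ m %% p ^ k)%N.
Proof.
elim: m => [|m IH]; first by rewrite expr0 -[1]/(1%:R) residue_natr.
by rewrite exprS residueM IH modnMmr -expnS.
Qed.

Lemma residue_sum (I : Type) (r : seq I) (P : pred I) (f : I -> Zp) k :
  (\sum_(i <- r | P i) f i) k = ((\sum_(i <- r | P i) f i k) %% p ^ k)%N.
Proof.
elim/big_rec2: _ => [|i m z _ IH]; first by rewrite residue0 mod0n.
by rewrite residueD IH modnDmr.
Qed.

Lemma residue_sub x y k : x k = y k -> (x - y) k = 0%N.
Proof.
move=> e; have : (x - y + y) k = y k by rewrite subrK.
rewrite residueD -[RHS]residue_mod -{2}[y k]add0n => /eqP.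
by rewrite eqn_modDr mod0n residue_mod => /eqP.
Qed.

(** The quotient has as residue at level [n] that of [x] at level [n + m], divided by [p ^ m]. *)
Lemma dvd_pX x m : x m = 0%N -> exists y, x = p%:R ^+ m * y.
Proof.
move=> xm; have dv n : (p ^ m %| x (n + m)%N)%N.
  by rewrite /dvdn (residue_mod_le x (leq_addl n m)) xm.
have h n : (x (n + m)%N %/ p ^ m = x (n.+1 + m)%N %/ p ^ m %[mod p ^ n])%N.
  rewrite (residue_compat x (n + m)) {1}[(p ^ (n + m))%N]expnD modn_divl.
  by rewrite modn_mod modn_divl addSn.
exists (of_nats hp h); apply: padic_int_ext => n.
rewrite -natrX residueM residue_natr modnMml /= modnMmr.
by rewrite mulnC divnK// (residue_mod_le x (leq_addr m n)).
Qed.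

(** The unit part of [x] is inverted modulo each [p ^ n] by Euler's theorem, and uniqueness of
    inverses makes these residues compatible. *)
Lemma exists_padic_int_inv x : x != 0 ->
  exists y, x * y = p%:R ^+ padic_int_val x.
Proof.
move=> x0; set m := padic_int_val x.
have /dvd_pX[y xE] : x m = 0%N by apply/eqP; rewrite padic_int_valP.
have y1 : y 1%N != 0%N.
  have : x m.+1 != 0%N by rewrite padic_int_valP// -ltnNge.
  apply: contraNneq => y1; rewrite xE -natrX residueM residue_natr modnMml.
  have := residue_mod_le y (ltn0Sn m); rewrite y1 => /eqP; rewrite expn1 -/(dvdn _ _).
  move=> /dvdnP[c ->]; rewrite mulnCA -[(p ^ m * p)%N]mulnC -expnS.
  by rewrite modnMl.
have cop n : coprime (y n) (p ^ n).
  case: n => [|n]; first by rewrite expn0 coprimen1.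
  rewrite coprime_sym coprimeXl// prime_coprime//; apply: contra y1 => dv.
  by rewrite -(residue_mod_le y (ltn0Sn n)) expn1.
pose f n := (y n ^ (totient (p ^ n)).-1)%N.
have fP n : (y n * f n = 1 %[mod p ^ n])%N.
  rewrite -expnS prednK ?totient_gt0 ?pexp_gt0//.
  exact: Euler_exp_totient.
have fc n : (f n = f n.+1 %[mod p ^ n])%N.
  have e : (y n * f n = y n * f n.+1 %[mod p ^ n])%N.
    rewrite fP (residue_compat y n) modnMml.
    have /(congr1 (fun m => m %% p ^ n)%N) := fP n.+1.
    by rewrite !modn_dvdm ?dvdn_exp2l// => ->.
  have := congr1 (fun m => f n * m %% p ^ n)%N e.
  rewrite /= !modnMmr !mulnA ![(f n * y n)%N]mulnC.
  by rewrite -!(modnMml (y n * f n)%N) !fP !modnMml !mul1n.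
exists (of_nats hp fc); rewrite xE -mulrA.
suff -> : y * of_nats hp fc = 1 by rewrite mulr1.
apply: padic_int_ext => n.
by rewrite residueM /= modnMmr fP -(residue_natr 1).
Qed.

End PadicInt.

Section Padic.
Variables (R : realType) (p : nat) (hp : prime p).
Local Notation Zp := (padic_int hp).
Local Notation Qp := (padic hp).

Lemma tofrac_natr m : (m%:R : Zp)%:F = m%:R :> Qp.
Proof. exact: rmorph_nat. Qed.

Lemma tofrac_X (z : Zp) m : (z ^+ m)%:F = z%:F ^+ m :> Qp.
Proof. exact: rmorphXn. Qed.

Lemma natrp_neq0 : p%:R != 0 :> Zp.
Proof.
apply/eqP => /(congr1 (fun x : Zp => x 2%N)); rewrite residue0 residue_natr.
have p1 := prime_gt1 hp.
have pp : (p < p ^ 2)%N by rewrite -[X in (X < _)%N]expn1 ltn_exp2l.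
by rewrite (modn_small pp) => p0; rewrite p0 in p1.
Qed.

Lemma Qp_natrp_neq0 : p%:R != 0 :> Qp.
Proof. by rewrite -tofrac_natr tofrac_eq0 natrp_neq0. Qed.

Lemma padic_abs1 : padic_abs R (1 : Qp) = 1.
Proof.
have := padic_absM R (1 : Qp) 1; rewrite mulr1 => /eqP.
by rewrite -subr_eq0 -{1}[padic_abs R 1]mulr1 -mulrBr mulf_eq0 padic_abs_eq0
  oner_eq0/= subr_eq0 eq_sym => /eqP.
Qed.

Lemma padic_absX (x : Qp) m : padic_abs R (x ^+ m) = padic_abs R x ^+ m.
Proof.
by elim: m => [|m IH]; rewrite ?expr0 ?padic_abs1// !exprS padic_absM IH.
Qed.

Lemma padic_abs_int (z : Zp) k :
  (padic_abs R (z%:F : Qp) <= p%:R ^- k) = (z k == 0%N).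
Proof.
have [->|z0] := eqVneq z 0.
  by rewrite residue0 eqxx tofrac0 padic_abs0 invr_ge0 exprn_ge0.
have p1 : 1 < p%:R :> R by rewrite ltr1n prime_gt1.
have v1 : padic_int_val (1 : Zp) = 0%N.
  apply: padic_int_val_unique; first exact: residue_nat0.
  have : (1 : Zp) 1%N = (1 %% p ^ 1)%N by exact: (residue_natr hp 1).
  by rewrite expn1 modn_small ?prime_gt1// => ->.
have -> : (z%:F : Qp) = z%:F / 1%:F by rewrite tofrac1 divr1.
rewrite padic_abs_frac ?oner_neq0// v1 padic_int_valP// exprnN ler_eXz2l//.
lia.
Qed.

(** All large [m] are allowed, so that finitely many elements can share one power of [p]. *)
Lemma padic_clear (x : Qp) :
  exists M, forall m, (M <= m)%N -> exists z : Zp, p%:R ^+ m * x = z%:F.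
Proof.
have [a [b [b0 xE _ _]]] := padic_fracP x.
have [y yE] := exists_padic_int_inv b0.
exists (padic_int_val b) => m /subnK <-.
exists (p%:R ^+ (m - padic_int_val b) * (a * y)).
have e : p%:R ^+ padic_int_val b = b%:F * y%:F :> Qp.
  by rewrite -tofracM yE tofrac_X tofrac_natr.
rewrite exprD -mulrA tofracM tofrac_X tofrac_natr e xE tofracM [b%:F * _]mulrC.
by rewrite mulrACA divff ?tofrac_eq0// mulr1 [y%:F * _]mulrC.
Qed.

Lemma padic_abs_le1 (x : Qp) : padic_abs R x <= 1 -> exists z : Zp, x = z%:F.
Proof.
move=> x1; have [M /(_ M (leqnn M))[z zE]] := padic_clear x.
have : padic_abs R (z%:F : Qp) <= p%:R ^- M.
  rewrite -zE padic_absM padic_absX padic_abs_p exprVn.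
  by rewrite ler_piMr// invr_ge0 exprn_ge0.
rewrite padic_abs_int => /eqP/dvd_pX[y yE]; exists y.
have pM0 : p%:R ^+ M != 0 :> Qp by rewrite expf_neq0 ?Qp_natrp_neq0.
by apply: (mulfI pM0); rewrite zE yE tofracM tofrac_X tofrac_natr.
Qed.

End Padic.

Section Classes.
Variables (p : nat) (hp : prime p) (m : nat).
Local Notation Zp := (padic_int hp).
Local Notation cls k := {ffun 'I_m -> 'I_(p ^ k)}.

Definition reduce k (f : 'I_m -> nat) : cls k :=
  [ffun i => Ordinal (ltn_pmod (f i) (pexp_gt0 hp k))].

Definition residues k (x : 'I_m -> Zp) : cls k := reduce k (fun i => x i k).

Lemma reduceE k f i : reduce k f i = (f i %% p ^ k)%N :> nat.
Proof. by rewrite ffunE. Qed.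

Lemma residuesE k x i : residues k x i = x i k :> nat.
Proof. by rewrite reduceE residue_mod. Qed.

Lemma reduce_eqP k f g :
  reduce k f = reduce k g <-> (forall i, f i = g i %[mod p ^ k])%N.
Proof.
split=> [e i|e]; first by rewrite -!reduceE e.
by apply/ffunP => i; apply/val_inj; rewrite /= !reduceE.
Qed.

Definition restrict K k (f : cls K) : cls k := reduce k (fun i => f i).

Lemma card_reduce_preim k K (B : {set cls k}) : (k <= K)%N ->
  (#|[set f : cls K | restrict k f \in B]%SET| <= #|B| * p ^ (m * (K - k)))%N.
Proof.
move=> kK.
have lt (f : cls K) i : (f i %/ p ^ k < p ^ (K - k))%N.
  by rewrite ltn_divLR ?pexp_gt0// -expnD subnK.
pose h (f : cls K) : cls k * cls (K - k) :=
  (restrict k f, [ffun i => Ordinal (lt f i)]).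
have h_inj : injective h.
  move=> f g [/reduce_eqP e1 /ffunP e2]; apply/ffunP => i; apply/val_inj => /=.
  rewrite (divn_eq (f i) (p ^ k)) (divn_eq (g i) (p ^ k)) e1.
  by have := e2 i; rewrite !ffunE => /(congr1 val) /= ->.
rewrite -(card_imset _ h_inj).
have -> : (p ^ (m * (K - k)) = #|[set: cls (K - k)]%SET|)%N.
  by rewrite cardsT card_ffun !card_ord -expnM mulnC.
rewrite -cardsX; apply/subset_leq_card/fintype.subsetP => _ /imsetP[f + ->].
by rewrite inE => fB; rewrite inE /= fB inE.
Qed.

(* Koenig's lemma on the tree of classes not below any [B k]. *)
Lemma exists_uncovered (R : realType) (B : forall k, {set cls k}) :
  (forall K, \sum_(k < K) #|B k|%:R / p%:R ^+ (m * k) < 1 :> R) ->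
  exists x : 'I_m -> Zp, forall k, residues k x \notin B k.
Proof.
move=> small.
pose free K (f : 'I_m -> nat) := forall k, (k < K)%N -> reduce k f \notin B k.
have p0 : 0 < p%:R :> R by rewrite ltr0n prime_gt0.
have exfree K : exists f, free K f.
  (* The classes of level [K] below some [B k] with [k < K]; by [small] they are not all the
     classes. *)
  pose bad := (\bigcup_(k < K) [set f : cls K | restrict k f \in B k])%SET.
  have : (#|bad| < #|[set: cls K]%SET|)%N.
    rewrite cardsT card_ffun !card_ord -expnM mulnC -(ltr_nat R).
    have pK : 0 < p%:R ^+ (m * K) :> R by rewrite exprn_gt0.
    rewrite natrX -[ltRHS]mul1r; have := small K.
    set S := (X in X < 1) => S1.
    apply: (@le_lt_trans _ _ (S * p%:R ^+ (m * K))); last by rewrite ltr_pM2r.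
    rewrite /S {S S1}.
    rewrite mulr_suml; apply: (@le_trans _ _
      (\sum_(k < K) #|[set f : cls K | restrict k f \in B k]%SET|%:R)).
      rewrite -natr_sum ler_nat /bad.
      elim/big_ind2: _ => [|s1 n1 s2 n2 h1 h2|k _]; rewrite ?cards0//.
      by rewrite cardsU (leq_trans (leq_subr _ _))// leq_add.
    apply: ler_sum => k _.
    have kK := ltnW (ltn_ord k).
    have -> : (p%:R ^+ (m * K) = p%:R ^+ (m * k) * p%:R ^+ (m * (K - k)) :> R).
      by rewrite -exprD -mulnDr subnKC.
    rewrite mulrA divfK ?expf_neq0 ?gt_eqF// -natrX -natrM ler_nat.
    exact: card_reduce_preim.
  move=> badlt.
  have [f fbad] : exists f : cls K, f \notin bad.
    apply: contrapT => /forallNP nf; move: badlt.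
    rewrite ltnNge => /negP; apply; apply/subset_leq_card/fintype.subsetP => f _.
    by apply: contrapT => /negP /nf.
  exists (fun i => f i) => k kK; apply: contra fbad => fB.
  by apply/bigcupP; exists (Ordinal kK) => //; rewrite inE.
(* The class of [f] modulo [p ^ K] has free lifts of every depth. *)
pose good K f := forall N, (K <= N)%N ->
  exists2 f', free N f' & forall i, (f' i = f i %[mod p ^ K])%N.
have good0 : good 0%N (fun=> 0%N).
  by move=> N _; have [f fN] := exfree N; exists f => // i; rewrite expn0 !modn1.
have step K f : good K f -> exists f', good K.+1 f' /\
    forall i, (f' i = f i %[mod p ^ K])%N.
  move=> gf.
  (* A class that is not good has no free lift at some depth [N c]. A free lift of [f] at the
     maximum of these depths therefore lies in a good class of level [K.+1]. *)
  have /choice[N NP] : forall c : cls K.+1, exists N,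
      (K < N)%N /\ (good K.+1 (fun i => c i) \/
      forall f', free N f' -> ~ forall i, (f' i = c i %[mod p ^ K.+1])%N).
    move=> c; have [gc|ngc] := pselect (good K.+1 (fun i => c i)).
      by exists K.+1; split => //; left.
    move/existsNP: ngc => [N /not_implyP[KN /forall2NP h]]; exists N; split=> //.
    by right=> f' f'N f'c; case: (h f').
  have KM : (K <= \max_c N c + K)%N by rewrite leq_addl.
  have [f' f'free f'E] := gf _ KM.
  exists f'; split => //; have [_ [gc|]] := NP (reduce K.+1 f').
    move=> M KM'; have [f'' h1 h2] := gc M KM'; exists f'' => // i.
    by rewrite h2 reduceE modn_mod.
  move=> /(_ f')[].
    move=> k kN; apply: f'free; apply: leq_trans kN _.
    by rewrite (leq_trans (leq_bigmax (reduce K.+1 f')))// leq_addr.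
  by move=> i; rewrite reduceE modn_mod.
have /choice[next nextP] : forall Kf : nat * ('I_m -> nat), exists f',
    good Kf.1 Kf.2 -> good Kf.1.+1 f' /\
      forall i, (f' i = Kf.2 i %[mod p ^ Kf.1])%N.
  move=> [K f] /=; have [gf|ngf] := pselect (good K f); last by exists f.
  by have [f' h] := step K f gf; exists f'.
pose s := fix s K := if K is K'.+1 then next (K', s K') else fun=> 0%N.
have sgood K : good K (s K).
  by elim: K => [|K IH] //=; case: (nextP (K, s K) IH).
have sE K i : (s K i = s K.+1 i %[mod p ^ K])%N.
  by have [_ /(_ i)] := nextP (K, s K) (sgood K).
exists (fun i => of_nats hp (fun K => sE K i)) => k.
have [f' f'free f'E] := sgood k.+1 k.+1 (leqnn _).
have -> : residues k (fun i => of_nats hp (sE^~ i)) = reduce k f'.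
  apply/reduce_eqP => i; rewrite /= modn_mod sE.
  have dv : (p ^ k %| p ^ k.+1)%N by rewrite dvdn_exp2l.
  by rewrite -(modn_dvdm _ dv) -f'E modn_dvdm.
exact: f'free.
Qed.

End Classes.

(** * Hausdorff measure *)

Section Hausdorff.
Variables (R : realType) (T : Type) (dist : T -> T -> R).
Implicit Types (A : set T) (s delta : R).
Local Open Scope ereal_scope.
Local Notation diam := (diameter dist).
Local Notation dpow := (diameter_pow dist).
Local Notation prem := (hausdorff_premeasure dist).
Local Notation hmeas := (hausdorff_measure dist).

Lemma diameter_pow_ge0 s A : 0 <= dpow s A.
Proof. by rewrite /diameter_pow; case: ifP => // _; exact: poweR_ge0. Qed.

Lemma diameter_pow_le s A (c : R) : (forall x y, 0 <= dist x y)%R ->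
  (0 <= s)%R -> (0 <= c)%R -> diam A <= c%:E -> dpow s A <= (c `^ s)%:E.
Proof.
move=> dist0 s0 c0 Ac; rewrite /diameter_pow; case: ifPn => [_|/set0P[x Ax]].
  by rewrite lee_fin powR_ge0.
rewrite -poweR_EFin; apply: gt0_ler_poweR => //; rewrite in_itv/= leey andbT//.
apply: (@le_trans _ _ (dist x x)%:E); first by rewrite lee_fin.
by apply: ereal_sup_ubound; exists x, x.
Qed.

Lemma premeasure_ge0 s delta A : 0 <= prem s delta A.
Proof.
apply: le_ereal_inf_tmp => _ [U _ <-].
by apply: nneseries_ge0 => k _ _; exact: diameter_pow_ge0.
Qed.

Lemma le_premeasure s delta A B : A `<=` B -> prem s delta A <= prem s delta B.
Proof.
move=> AB; apply: ereal_inf_le_tmp => _ [U [BU Udelta] <-].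
by exists U => //; split => //; exact: subset_trans BU.
Qed.

Lemma diameter0 : diam set0 = -oo.
Proof.
rewrite /diameter (_ : [set _ | _] = set0) ?ereal_sup0//.
by apply/seteqP; split => // r [x [y []]].
Qed.

(** The cover is padded with empty sets, whose diameter is [-oo] and whose weight is 0. *)
Lemma premeasure_fin s delta A (I : finType) (U : I -> set T) :
  A `<=` \bigcup_i U i -> (forall i, diam (U i) <= delta%:E) ->
  prem s delta A <= \sum_i dpow s (U i).
Proof.
move=> AU Ud.
pose W k := if insub k is Some k' then U (@enum_val I xpredT k') else set0.
have WE : \sum_(0 <= k <oo) dpow s (W k) = \sum_i dpow s (U i).
  rewrite (nneseries_split 0%N #|I|); last by move=> k _; exact: diameter_pow_ge0.
  rewrite add0n eseries0 ?adde0; last first.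
    by move=> k Ik _; rewrite /W insubF ?ltnNge ?Ik// /diameter_pow eqxx.
  rewrite big_mkord [RHS](reindex (@enum_val I xpredT)); last first.
    exact/onW_bij/enum_val_bij.
  by apply: eq_bigr => i _; rewrite /W valK.
rewrite -WE; apply: ereal_inf_lbound; exists W => //; split.
  move=> x /AU[i _ Uix]; exists (enum_rank i) => //.
  by rewrite /W valK enum_rankK.
by move=> k; rewrite /W; case: insubP => [//|_]; rewrite diameter0 leNye.
Qed.

(** Near-optimal covers with errors [e / 2 ^ n.+1] are merged by enumerating pairs of indices. *)
Lemma premeasure_bigcup s delta (A : nat -> set T) (c : nat -> R) :
  (forall j, prem s delta (A j) <= (c j)%:E) ->
  prem s delta (\bigcup_j A j) <= \sum_(0 <= j <oo) (c j)%:E.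
Proof.
move=> hc.
have c0 j : 0 <= (c j)%:E by exact: le_trans (premeasure_ge0 _ _ _) (hc j).
apply/lee_addgt0Pr => e e0.
rewrite (le_trans _ (epsilon_trick _ _ (ltW e0)))//.
pose P n (B : nat -> set T) := delta_cover dist delta (A n) B /\
  \sum_(0 <= k <oo) dpow s (B k) <= (c n)%:E + (e / (2 ^ n.+1)%:R)%:E.
have /choice[G PG] n : exists B, P n B.
  have en : (c n)%:E < (c n)%:E + (e / (2 ^ n.+1)%:R)%:E.
    by rewrite lteDl// lte_fin divr_gt0// ltr0n expn_gt0.
  have /ereal_inf_lt[_ [B cB <-] lt] := le_lt_trans (hc n) en.
  by exists B; split => //; exact: ltW.
pose D := dpow s \o uncurry G.
have D0 x : 0 <= D x by exact: diameter_pow_ge0.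
apply: (@le_trans _ _ (\esum_(i in setT) D i)).
  apply: ereal_inf_lbound => /=.
  have /card_esym/ppcard_eqP[f] := card_nat2.
  exists (uncurry G \o f).
    split => [|i]; last by rewrite /=; case: (f i) => a b; exact: (PG a).1.2.
    move=> t [i _ /(PG i).1.1[j _ Gt]]; exists (f^-1%FUN (i, j)) => //=.
    by rewrite invK ?inE.
  rewrite -(esum_pred_image D _ xpredT) ?[fun=> _]set_true//.
  by rewrite image_eq.
rewrite (_ : esum _ _ = \sum_(0 <= i <oo) \sum_(0 <= j <oo) dpow s (G i j)).
  apply: lee_nneseries => [i _ _|i _]; last exact: (PG i).2.
  by apply: nneseries_ge0 => *; exact: diameter_pow_ge0.
rewrite nneseries_esumT; last first.
  by move=> i; apply: nneseries_ge0 => *; exact: diameter_pow_ge0.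
transitivity (\esum_(i in setT) \esum_(j in setT) dpow s (G i j)); last first.
  apply: eq_esum => i _; rewrite nneseries_esumT// => j.
  exact: diameter_pow_ge0.
rewrite esum_esum; last by move=> i j _ _; exact: diameter_pow_ge0.
congr esum.
by apply/seteqP; split => // -[].
by apply/funext => -[].
Qed.

Lemma premeasure_levels s delta A (I : nat -> finType)
    (U : forall k, I k -> set T) (c : nat -> R) :
  (forall x, A x -> exists k i, U k i x) ->
  (forall k i, diam (U k i) <= delta%:E) ->
  (forall k, \sum_i dpow s (U k i) <= (c k)%:E) ->
  prem s delta A <= \sum_(0 <= k <oo) (c k)%:E.
Proof.
move=> AU Ud Uc.
have AB : A `<=` \bigcup_k \bigcup_i U k i.
  by move=> x /AU[k [i Ux]]; exists k => //; exists i.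
apply: le_trans (le_premeasure _ _ AB) _.
apply: premeasure_bigcup => k; apply: le_trans (Uc k).
by apply: premeasure_fin => [|i]; [move=> x [i _ Ux]; exists i|exact: Ud].
Qed.

Lemma hausdorff_null s A :
  (forall delta, (0 < delta)%R -> forall e, (0 < e)%R -> prem s delta A <= e%:E) ->
  hmeas s A = 0.
Proof.
move=> h; apply/eqP; rewrite eq_le; apply/andP; split.
  apply: ge_ereal_sup => _ [delta /= d0 <-]; apply/lee_addgt0Pr => e e0.
  by rewrite add0e h.
apply: le_trans (premeasure_ge0 s 1%R A) _.
by apply: ereal_sup_ubound; exists 1%R => //=.
Qed.

Lemma null_premeasure s delta A : (0 < delta)%R -> hmeas s A = 0 ->
  prem s delta A = 0.
Proof.
move=> d0 h0; apply/eqP; rewrite eq_le premeasure_ge0 andbT -h0.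
by apply: ereal_sup_ubound; exists delta.
Qed.

Lemma null_bigcup s (A : nat -> set T) :
  (forall j, hmeas s (A j) = 0) -> hmeas s (\bigcup_j A j) = 0.
Proof.
move=> A0; apply: hausdorff_null => delta d0 e e0.
apply: le_trans (premeasure_bigcup (c := fun=> 0%R) _) _.
  by move=> j; rewrite null_premeasure.
by rewrite eseries0// lee_fin ltW.
Qed.

Lemma sub_null s A B : A `<=` B -> hmeas s B = 0 -> hmeas s A = 0.
Proof.
move=> AB B0; apply: hausdorff_null => delta d0 e e0.
apply: le_trans (le_premeasure s delta AB) _.
by rewrite null_premeasure// lee_fin ltW.
Qed.

(** In exponent 0, a member of the cover that contains a given point has weight 1. *)
Lemma hausdorff0_neq0 A : A !=set0 -> hmeas 0 A != 0.
Proof.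
move=> [x Ax]; apply/negP => /eqP /(null_premeasure ltr01) h.
have : 1 <= prem 0 1 A.
  apply: le_ereal_inf_tmp => _ [U [AU _] <-]; have [k _ Ukx] := AU x Ax.
  have -> : 1 = \sum_(k <= i < k.+1) dpow 0 (U i).
    rewrite big_nat1 /diameter_pow poweRe0 ifF//; apply/negP => /eqP Uk.
    by rewrite Uk in Ukx.
  apply: (@le_trans _ _ (\sum_(0 <= i < k.+1) dpow 0 (U i))).
    rewrite [leRHS](big_cat_nat (leq0n k) (leqnSn k))/= leeDr// sume_ge0// => i _.
    exact: diameter_pow_ge0.
  by apply: nneseries_lim_ge => i _ _; exact: diameter_pow_ge0.
by rewrite h leNgt lte01.
Qed.

Lemma hausdorff_dim_le s A : (0 <= s)%R -> hmeas s A = 0 ->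
  hausdorff_dim dist A <= s%:E.
Proof. by move=> s0 h; apply: ereal_inf_lbound; exists s. Qed.

Lemma le_hausdorff_dim (b : \bar R) A :
  (forall s, (0 <= s)%R -> hmeas s A = 0 -> b <= s%:E) ->
  b <= hausdorff_dim dist A.
Proof. by move=> h; apply: le_ereal_inf_tmp => _ [s [s0 /h hs] <-]; exact: hs. Qed.

End Hausdorff.

(** * From covers to families of residue classes *)

Section Scale.
Variables (R : realType) (p : nat) (hp : prime p).
Local Notation pR := (p%:R : R).

Let p1 : 1 < pR. Proof. by rewrite ltr1n prime_gt1. Qed.
Let p0 : 0 < pR. Proof. exact: lt_trans p1. Qed.

Lemma exists_expV_le (e : R) : 0 < e -> exists k, pR ^- k <= e.
Proof.
move=> e0; have e'0 : 0 <= e^-1 by rewrite invr_ge0 ltW.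
exists (Num.bound e^-1); rewrite -[leRHS]invrK lef_pV2 ?posrE ?exprn_gt0 ?invr_gt0//.
rewrite (le_trans (ltW (archi_boundP e'0)))// -natrX ler_nat ltnW// ltn_expl//.
exact: prime_gt1.
Qed.

Lemma powRN_exprn (s : R) k : (pR `^ (- s)) ^+ k = (pR ^- k) `^ s.
Proof.
have -> : pR ^- k = pR `^ (- k%:R) by rewrite powRN powR_mulrn ?ltW.
by rewrite -powR_mulrn ?powR_ge0// -!powRrM; congr (_ `^ _); ring.
Qed.

Lemma powRN_le1 (s : R) : 0 <= s -> pR `^ (- s) <= 1.
Proof.
by move=> s0; rewrite -[leRHS](powRr0 pR) ler_powR ?oppr_le0// ltW.
Qed.

(** If [D > 0], the largest [k] with [D <= p ^- k] satisfies [p ^- k < p * D], which costs the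
    factor [p ^ s]. If [D = 0], a level of weight at most [eta] is taken. *)
Lemma exists_scale (s D eta : R) (k0 : nat) : 0 < s -> 0 < eta -> 0 <= D ->
  D <= pR ^- k0 ->
  exists k, [/\ (k0 <= k)%N, D <= pR ^- k &
    (pR `^ (- s)) ^+ k <= pR `^ s * D `^ s + eta].
Proof.
move=> s0 eta0 D0 Dk0; have pV0 k : 0 < pR ^- k by rewrite invr_gt0 exprn_gt0.
have [all|/existsNP[k1 /negP]] := pselect (forall k, D <= pR ^- k).
  have [j jP] := exists_expV_le (powR_gt0 s^-1 eta0).
  exists (k0 + j)%N; split => //; first exact: leq_addr.
  rewrite exprD; apply: (@le_trans _ _ (1 * (pR `^ (- s)) ^+ j)).
    rewrite ler_pM2r ?exprn_gt0 ?powR_gt0// exprn_ile1 ?powR_ge0//.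
    exact/powRN_le1/ltW.
  rewrite mul1r powRN_exprn.
  have : (pR ^- j) `^ s <= (eta `^ s^-1) `^ s.
    by apply: ge0_ler_powR => //; rewrite ?nnegrE ?powR_ge0// ltW.
  rewrite -powRrM mulVf ?gt_eqF// (powRr1 (ltW eta0)) => /le_trans; apply.
  by rewrite lerDr mulr_ge0 ?powR_ge0.
rewrite -ltNge => k1P.
have ex : exists k, pR ^- k < D by exists k1.
have [k kD kmin] := ex_minnP ex.
have kk0 : (k0 < k)%N.
  rewrite ltnNge; apply/negP => kk0; move: (lt_le_trans kD Dk0).
  by rewrite ltf_pV2 ?posrE ?exprn_gt0// ltr_eXn2l// ltnNge kk0.
case: k kD kmin kk0 => // k kD kmin kk0; exists k; split => //.
  by rewrite leNgt; apply/negP => /kmin; rewrite ltnn.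
rewrite ler_wpDr ?(ltW eta0)// powRN_exprn.
have -> : pR ^- k = pR * pR ^- k.+1 by rewrite exprS invfM mulrA divff ?gt_eqF// mul1r.
rewrite powRM ?(ltW p0) ?(ltW (pV0 _))// ler_pM2l ?powR_gt0//.
by apply: ge0_ler_powR (ltW kD) => //; rewrite ?nnegrE// ltW.
Qed.

Lemma sum_halves (eta : R) N : 0 <= eta ->
  \sum_(i < N) eta / 2 ^+ i.+1 <= eta.
Proof.
move=> eta0; have -> : \sum_(i < N) eta / 2 ^+ i.+1 = eta - eta / 2 ^+ N.
  elim: N => [|N IH]; first by rewrite big_ord0 expr0 divr1 subrr.
  by rewrite big_ord_recr /= IH exprS; field; rewrite expf_neq0.
by rewrite gerBl divr_ge0 ?exprn_ge0.
Qed.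

End Scale.

Section Levels.
Variables (R : realType) (p : nat) (hp : prime p) (m : nat).
Variables (T : Type) (dist : T -> T -> R).
Local Notation Zp := (padic_int hp).
Local Notation cls k := {ffun 'I_m -> 'I_(p ^ k)}.
Local Notation pR := (p%:R : R).

Let p1 : 1 < pR. Proof. by rewrite ltr1n prime_gt1. Qed.

(** At the level given by [exists_scale] for its diameter, a member of the cover meets the image of
    [psi] within one residue class, by [psi_res]; that class replaces it. *)
Lemma null_levels (psi : ('I_m -> Zp) -> T) (A : set T) (s : R) :
  (forall x y, 0 <= dist x y) ->
  (forall x y k, dist (psi x) (psi y) <= pR ^- k ->
     residues k x = residues k y) ->
  0 < s -> hausdorff_measure dist s A = 0%E ->
  forall (e : R) k0, 0 < e -> exists B : forall k, {set cls k},
    [/\ forall k, (k < k0)%N -> B k = finset.set0,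
        forall K, \sum_(k < K) #|B k|%:R * (pR `^ (- s)) ^+ k <= e &
        forall x, A (psi x) -> exists k, residues k x \in B k].
Proof.
move=> dist0 psi_res s0 A0 e k0 e0.
(* Half of [e], corrected for the factor lost in [exists_scale]; the other half pays for the errors
   [eta]. *)
pose e1 := e / 2 / pR `^ s.
have ps0 : 0 < pR `^ s by rewrite powR_gt0// (lt_trans _ p1).
have e10 : 0 < e1 by rewrite !divr_gt0.
have delta0 : 0 < pR ^- k0 by rewrite invr_gt0 exprn_gt0// (lt_trans _ p1).
have : (hausdorff_premeasure dist s (pR ^- k0) A < e1%:E)%E.
  by rewrite (null_premeasure delta0 A0) lte_fin.
move=> /ereal_inf_lt[_ [U [AU Udelta] <-] Usum].
pose good i := exists x, U i (psi x).
pose w i : R := fine (diameter_pow dist s (U i)).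
have Ufin i : diameter_pow dist s (U i) \is a fin_num.
  rewrite ge0_fin_numE ?diameter_pow_ge0//; apply: le_lt_trans (ltry e1).
  apply: le_trans (ltW Usum).
  apply: (@le_trans _ _ (\sum_(0 <= j < i.+1) diameter_pow dist s (U j))%E).
    by rewrite big_nat_recr//= leeDr// sume_ge0// => j _; exact: diameter_pow_ge0.
  by apply: nneseries_lim_ge => j _ _; exact: diameter_pow_ge0.
have wsum N : \sum_(i < N) w i <= e1.
  rewrite -lee_fin -sumEFin; apply: le_trans (ltW Usum).
  under eq_bigr => i _ do rewrite fineK//.
  rewrite -(big_mkord xpredT (fun i => diameter_pow dist s (U i))).
  by apply: nneseries_lim_ge => j _ _; exact: diameter_pow_ge0.
have w0 i : 0 <= w i by rewrite fine_ge0// diameter_pow_ge0.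
have /choice[xk xkP] : forall i, exists xk : ('I_m -> Zp) * nat, good i ->
    [/\ U i (psi xk.1), (k0 <= xk.2)%N,
      (forall y, U i (psi y) -> residues xk.2 y = residues xk.2 xk.1) &
      (pR `^ (- s)) ^+ xk.2 <= pR `^ s * w i + e / 2 / 2 ^+ i.+1].
  move=> i; have [[x Ux]|ng] := pselect (good i); last by exists (fun=> 0, 0%N) => /ng.
  have lb y z : U i y -> U i z -> ((dist y z)%:E <= diameter dist (U i))%E.
    by move=> Uy Uz; apply: ereal_sup_ubound; exists y, z.
  have Dfin : diameter dist (U i) = (fine (diameter dist (U i)))%:E.
    rewrite fineK// fin_numE; apply/andP; split.
      by rewrite -ltNye; apply: lt_le_trans (lb _ _ Ux Ux); exact: ltNyr.
    by rewrite -ltey; apply: le_lt_trans (Udelta i) (ltry _).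
  set D := fine _ in Dfin.
  have D0 : 0 <= D by rewrite -lee_fin -Dfin (le_trans _ (lb _ _ Ux Ux))// lee_fin.
  have Dk0 : D <= pR ^- k0 by rewrite -lee_fin -Dfin.
  have eta0 : 0 < e / 2 / 2 ^+ i.+1 by rewrite !divr_gt0 ?exprn_gt0.
  have [k [kk0 Dk kP]] := exists_scale hp s0 eta0 D0 Dk0.
  exists (x, k) => _; split => //=.
    move=> y Uy; apply: psi_res; apply: le_trans Dk.
    by rewrite -lee_fin -Dfin; exact: lb.
  have -> // : w i = D `^ s.
  rewrite /w /diameter_pow ifF ?Dfin ?poweR_EFin//.
  by apply/negP => /eqP Ui; rewrite Ui in Ux.
pose B k := [set c : cls k | `[< exists i, [/\ good i, (xk i).2 = k &
  c = residues k (xk i).1] >]]%SET.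
exists B; split.
- move=> k kk0; apply/setP => c; rewrite /B !inE; apply/negP => /asboolP[i [gi ik _]].
  by have [_ + _ _] := xkP i gi; rewrite ik leqNgt kk0.
- move=> K.
  (* Finitely many members account for all classes of level below [K]. *)
  have [N NP] : exists N, forall k (c : cls k), (k < K)%N -> c \in B k ->
      exists i : 'I_N, [/\ good i, (xk i).2 = k & c = residues k (xk i).1].
    have /choice[M MP] : forall k, exists N, forall c : cls k, c \in B k ->
      exists i : 'I_N, [/\ good i, (xk i).2 = k & c = residues k (xk i).1].
      move=> k.
      have /choice[f fP] : forall c : cls k, exists i, c \in B k ->
          [/\ good i, (xk i).2 = k & c = residues k (xk i).1].
        move=> c; have [|nc] := boolP (c \in B k); last by exists 0%N.
        by rewrite inE => /asboolP[i iP]; exists i.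
      exists (\max_c (f c)).+1 => c cB.
      have cN : (f c < (\max_c (f c)).+1)%N by rewrite ltnS (leq_bigmax c).
      by exists (Ordinal cN) => /=; exact: fP.
    exists (\max_(k < K) M k) => k c kK /MP[i iP].
    have kN : (i < \max_(k < K) M k)%N.
      by rewrite (leq_trans (ltn_ord i))// (leq_bigmax (Ordinal kK)).
    by exists (Ordinal kN).
  have cardB k : (k < K)%N ->
      (#|B k| <= #|[set i : 'I_N | `[< good i >] && ((xk i).2 == k)]%SET|)%N.
    move=> kK.
    apply: leq_trans (leq_imset_card (fun i : 'I_N => residues k (xk i).1) _).
    apply/subset_leq_card/fintype.subsetP => c /(NP k c kK)[i [gi ik ->]].
    by apply/imsetP; exists i => //; rewrite inE ik eqxx andbT; apply/asboolP.
  set rho := pR `^ (- s); have rho0 : 0 <= rho by exact: powR_ge0.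
  apply: (@le_trans _ _ (\sum_(k < K) \sum_(i < N | `[< good i >] && ((xk i).2 == k))
      (pR `^ s * w i + e / 2 / 2 ^+ i.+1))).
    apply: ler_sum => k _.
    apply: (@le_trans _ _ (\sum_(i < N | `[< good i >] && ((xk i).2 == k)) rho ^+ k)).
      rewrite sumr_const -[leRHS]mulr_natl ler_wpM2r ?exprn_ge0// ler_nat.
      by rewrite (leq_trans (cardB k _))// cardsE.
    by apply: ler_sum => i /andP[/asboolP gi /eqP <-]; have [] := xkP i gi.
  under eq_bigr => k _ do rewrite big_mkcond/=.
  (* Each member has a single level, hence is counted at most once. *)
  rewrite exchange_big/=.
  apply: (@le_trans _ _ (\sum_(i < N) (pR `^ s * w i + e / 2 / 2 ^+ i.+1))).
    apply: ler_sum => i _; rewrite -big_mkcond/=.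
    have c0 : 0 <= pR `^ s * w i + e / 2 / 2 ^+ i.+1.
      apply: addr_ge0; first by rewrite mulr_ge0// ltW.
      by rewrite divr_ge0 ?exprn_ge0// divr_ge0// ltW.
    have [iK|iK] := ltnP (xk i).2 K; last first.
      rewrite big1// => k /andP[_ /eqP ik]; move: iK.
      by rewrite ik leqNgt ltn_ord.
    rewrite (@le_trans _ _ (\sum_(k < K | k == Ordinal iK)
      (pR `^ s * w i + e / 2 / 2 ^+ i.+1)))//; last by rewrite big_pred1_eq.
    rewrite [leLHS]big_mkcond [leRHS]big_mkcond; apply: ler_sum => k _.
    case: ifP => [/andP[_ /eqP ik]|_]; last by case: ifP.
    by rewrite ifT//; apply/eqP/val_inj.
  rewrite big_split /= -mulr_sumr.
  apply: (@le_trans _ _ (pR `^ s * e1 + e / 2)).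
    apply: lerD; first by rewrite ler_pM2l ?wsum.
    by apply: sum_halves; rewrite divr_ge0// ltW.
  by rewrite /e1 [_ * (_ / _)]mulrC divfK ?gt_eqF// -splitr.
- move=> x /AU[i _ Uix]; have gi : good i by exists x.
  have [Ui kk h _] := xkP i gi; exists (xk i).2; rewrite inE; apply/asboolP.
  by exists i; split => //; exact: h.
Qed.

End Levels.

(** With [x = k %/ (4 * q)], the left side is at most a constant times [x.+1 ^ 2], hence at most
    [x.+1 ^ 4], and [x.+1 <= p ^ x]. *)
Lemma quadratic_le_expn p q C : (1 < p)%N -> (0 < q)%N ->
  exists k1, forall k, (k1 <= k)%N -> (C * k.+2 ^ 2 <= p ^ (k %/ q))%N.
Proof.
move=> p1 q0; exists (4 * q * (C * (4 * q).+1 ^ 2))%N => k.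
set x := (k %/ (4 * q))%N; set D := (C * (4 * q).+1 ^ 2)%N => kD.
have q40 : (0 < 4 * q)%N by rewrite muln_gt0.
have xD : (D <= x.+1)%N by rewrite ltnW// ltnS leq_divRL// mulnC.
have xk : (x * 4 <= k %/ q)%N.
  by rewrite leq_divRL// -mulnA; apply: leq_divM.
have kx : (k.+2 <= (4 * q).+1 * x.+1)%N.
  have := ltn_ceil k q40; rewrite -/x; nia.
apply: (@leq_trans (x.+1 ^ 4)%N); last first.
  apply: leq_trans (leq_pexp2l (ltnW p1) xk); rewrite expnM.
  by rewrite leq_exp2r// ltn_expl.
apply: (@leq_trans (D * x.+1 ^ 2)%N).
  by rewrite /D -mulnA -expnMn leq_mul2l leq_exp2r// kx orbT.
rewrite -[4%N]/(2 + 2)%N expnD leq_mul2r; apply/orP; right.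
by apply: (leq_trans xD); rewrite expnS leq_pmulr ?expn_gt0.
Qed.

(** * Directions of curves that often meet a family of classes *)

Section ClassCount.
Variables (p : nat) (hp : prime p) (n d : nat).
Local Notation Zp := (padic_int hp).
Local Notation cls k := {ffun 'I_n -> 'I_(p ^ k)}.

Definition int_curve (al : nat -> 'I_n -> Zp) (mu : Zp) (nu : 'I_n -> Zp) (t : Zp)
    (c : 'I_n) : Zp :=
  \sum_(j < d.+1) al j c * t ^+ j + mu * nu c * t ^+ d.+1.

Lemma residue_int_curve al mu nu (t : Zp) (s : nat) c k :
  (t k = s %% p ^ k)%N ->
  int_curve al mu nu t c k =
  ((\sum_(j < d.+1) al j c k * s ^ j + mu k * nu c k * s ^ d.+1) %% p ^ k)%N.
Proof.
move=> ts; have tX j : ((t ^+ j) k = s ^ j %% p ^ k)%N.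
  by rewrite residueX ts modnXm.
rewrite residueD residue_sum !residueM tX modnDml modnMmr modnMml.
rewrite modnDmr; apply/eqP; rewrite eqn_modDr; apply/eqP.
elim/big_rec2: _ => // j y z _ e; rewrite residueM tX modnMmr.
by rewrite modnDml -modnDmr e modnDmr.
Qed.

Variable (c0 : 'I_n).

Definition hits k (Ek : {set cls k}) al mu nu : {set 'I_(p ^ k)} :=
  [set t : 'I_(p ^ k) | residues k (int_curve al mu nu (t : nat)%:R) \in Ek]%SET.

Definition rich k L N (Ek : {set cls k}) : set ('I_n -> Zp) :=
  [set nu | nu c0 = 1 /\ exists al mu,
     [/\ mu != 0, (padic_int_val mu <= L)%N & (N <= #|hits Ek al mu nu|)%N]].

(** One curve is chosen for each class of rich directions and reduced modulo [p ^ k]; [curves_count]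
    applies to these. *)
Lemma class_count k h m L (Ek : {set cls k}) (g := (h - L)%N)
    (v := logn p d.+1) (r0 := (L + (2 * v).+1)%N)
    (tau := ((d.+1 * n) * (h * p ^ h) + p ^ h)%N)
    (C := [set e : cls g | `[< exists2 nu, rich L (tau * p ^ (k - m)) Ek nu &
             e = residues g nu >] ]%SET) :
  (0 < h)%N -> (h <= k)%N -> (r0 <= h)%N -> (m <= k)%N ->
  (2 * (m * p ^ m) < p ^ k)%N ->
  (#|C| * p ^ (h - r0) * p ^ (h * (d * n)) * p ^ h.-1 <=
   2 * (p ^ k * p ^ (k * (d * n)) * #|Ek|))%N.
Proof.
move=> h0 hk r0h mk mK.
pose W := {e | e \in C}.
have /choice[D DP] : forall w : W, exists D : ('I_n -> Zp) * ((nat -> 'I_n -> Zp) * Zp),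
    [/\ val w = residues g D.1, D.1 c0 = 1, D.2.2 != 0, (padic_int_val D.2.2 <= L)%N &
      (tau * p ^ (k - m) <= #|hits Ek D.2.1 D.2.2 D.1|)%N].
  move=> w; have := valP w; rewrite inE.
  move=> /asboolP[nu [nu1 [al [mu [mu0 muL cnt]]]] eE].
  by exists (nu, (al, mu)).
have -> : #|C| = #|{: W}| by rewrite card_sig.
have Lk : (L < k)%N.
  by rewrite (leq_trans _ hk)// (leq_trans _ r0h)// /r0 addnS ltnS leq_addr.
apply: (@curves_count p hp n d k h m L _ (fun w j c => (D w).2.1 j c k)
  (fun w => (D w).2.2 k) (fun w c => (D w).1 c k) c0 Ek
  (fun w => hits Ek (D w).2.1 (D w).2.2 (D w).1)) => //.
- move=> w; have [_ _ mu0 muL _] := DP w.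
  have [|-> ->] := @residue_val _ _ _ k mu0; last by [].
  exact: leq_ltn_trans muL Lk.
- by move=> w; have [_ -> _ _ _] := DP w; rewrite (residue_natr hp 1) modn_mod.
- move=> w w' e; apply/val_inj; have [-> _ _ _ _] := DP w; have [-> _ _ _ _] := DP w'.
  apply/reduce_eqP => c; have gk : (g <= k)%N by rewrite (leq_trans (leq_subr _ _)).
  by rewrite !residue_mod -(residue_mod_le _ gk) e residue_mod_le.
- by move=> w; have [] := DP w.
- move=> w t; rewrite inE => tE; exists (residues k
    (int_curve (D w).2.1 (D w).2.2 (D w).1 (t : nat)%:R)) => // c.
  have ts : ((t : nat)%:R : Zp) k = (t %% p ^ k)%N by exact: residue_natr.
  rewrite residuesE (residue_int_curve _ _ _ _ ts) modn_mod.
  by rewrite -!mulnA.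
Qed.

End ClassCount.

(** The sum is [1 - 1 / (K + 1)]; these weights serve in [exists_uncovered]. *)
Lemma sum_inv_lt1 (R : realFieldType) K :
  \sum_(k < K) (k.+1 * k.+2)%N%:R^-1 < 1 :> R.
Proof.
have -> : \sum_(k < K) (k.+1 * k.+2)%N%:R^-1 = 1 - K.+1%:R^-1 :> R.
  elim: K => [|K IH]; first by rewrite big_ord0 invr1 subrr.
  rewrite big_ord_recr /= IH natrM; field.
  by rewrite !nat1r -!natrD !pnatr_eq0.
by rewrite ltrBlDr ltrDl invr_gt0.
Qed.

Section RichLevel.
Variables (R : realType) (p : nat) (hp : prime p) (n d : nat).
Local Notation Zp := (padic_int hp).
Local Notation cls k := {ffun 'I_n -> 'I_(p ^ k)}.

(** Otherwise the proportion of parameters hit at level [k] is below [1 / ((k + 1) * (k + 2))] for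
    all [k], and [exists_uncovered] in one variable yields a parameter never hit. *)
Lemma exists_rich_level (B : forall k, {set cls k}) (al : nat -> 'I_n -> Zp)
    (mu : Zp) (nu : 'I_n -> Zp) :
  (forall t : Zp, exists k, residues k (int_curve d al mu nu t) \in B k) ->
  exists k, (p ^ k <= #|hits d (B k) al mu nu| * (k.+1 * k.+2))%N.
Proof.
move=> cov; apply: contrapT => /forallNP few.
pose B' k := [set f : {ffun 'I_1 -> 'I_(p ^ k)} | f ord0 \in hits d (B k) al mu nu]%SET.
have [|x xP] := @exists_uncovered p hp 1 R B'.
  move=> K; apply: le_lt_trans (sum_inv_lt1 R K); apply: ler_sum => k _.
  rewrite mul1n ler_pdivrMr ?exprn_gt0 ?ltr0n ?prime_gt0// mulrC.
  rewrite ler_pdivlMr ?ltr0n// -natrX -natrM ler_nat.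
  have /negP := few k; rewrite -ltnNge => /ltnW; apply: leq_trans.
  rewrite leq_mul2r; apply/orP; right.
  have inj : injective (fun f : {ffun 'I_1 -> 'I_(p ^ k)} => f ord0).
    by move=> f g fg; apply/ffunP => i; rewrite !(ord1 i).
  rewrite -(card_imset _ inj); apply/subset_leq_card/fintype.subsetP.
  by move=> _ /imsetP[f + ->]; rewrite inE.
have [k kB] := cov (x ord0); have := xP k; rewrite /B' inE => /negP; apply.
rewrite inE; have -> // : residues k (int_curve d al mu nu
  (residues k x ord0 : nat)%:R) = residues k (int_curve d al mu nu (x ord0)).
apply/reduce_eqP => c; congr (_ %% _)%N.
have xk : (x ord0 k = x ord0 k %% p ^ k)%N by rewrite residue_mod.
rewrite (residue_int_curve _ _ _ _ _ xk).
by apply: residue_int_curve; rewrite residue_natr residuesE.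
Qed.

End RichLevel.

(** Since [k = h + 3 * l] and [k - m = l], a factor [p ^ (2 * l)] is left to absorb
    [(d.+1 * n * h + 1) * (k.+1 * k.+2)], which is polynomial in [k]. *)
Lemma level_params p n d q r : (1 < p)%N -> (4 <= q)%N -> exists k1, forall k,
  (k1 <= k)%N -> let l := (k %/ q)%N in
  let h := (k - 3 * l)%N in let m := (k - l)%N in
  [/\ (0 < h)%N, (r <= h)%N, (2 * (m * p ^ m) < p ^ k)%N &
    ((((d.+1 * n) * (h * p ^ h) + p ^ h) * p ^ (k - m)) * (k.+1 * k.+2) <= p ^ k)%N].
Proof.
move=> p1 q4; have q0 : (0 < q)%N by exact: leq_trans q4.
have [k1 k1P] := quadratic_le_expn (d.+1 * n + 2) p1 q0.
exists (k1 + 4 * r.+1)%N => k k1k l h m.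
have lk : (4 * l <= k)%N.
  by rewrite (leq_trans _ (leq_divM k q))// mulnC leq_mul2l q4 orbT.
have hr : (r.+1 <= h)%N by rewrite /h; lia.
have := k1P k (leq_trans (leq_addr _ _) k1k); rewrite -/l => lP.
have pm : (p ^ k = p ^ l * p ^ m)%N by rewrite -expnD subnKC//; lia.
have pg : (p ^ k = p ^ h * p ^ l * (p ^ l * p ^ l))%N.
  by rewrite -!expnD; congr expn; rewrite /h; lia.
split; [lia|lia| |].
  rewrite pm mulnA ltn_mul2r expn_gt0 (ltnW p1)/=; apply: leq_trans lP.
  have : (m <= k)%N by exact: leq_subr.
  nia.
have -> : (k - m = l)%N by rewrite /m; lia.
have -> : (((d.+1 * n * (h * p ^ h) + p ^ h) * p ^ l) * (k.+1 * k.+2) =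
   p ^ h * p ^ l * ((d.+1 * n * h + 1) * (k.+1 * k.+2)))%N by ring.
rewrite pg leq_mul2l; apply/orP; right; apply: leq_mul; apply: leq_trans lP.
  have : (h <= k)%N by exact: leq_subr.
  move: (d.+1 * n)%N => D; nia.
rewrite -[X in (X <= _)%N]mul1n leq_mul//; first by rewrite addn2.
rewrite -mulnn leq_mul2r leqnSn orbT//.
Qed.

(** * Dimension of the set of directions *)

Section Geometry.
Variables (R : realType) (p : nat) (hp : prime p).
Local Notation Zp := (padic_int hp).
Local Notation Qp := (padic hp).
Local Notation pR := (p%:R : R).

Lemma proj_dist_ge0 n (x y : proj_space Qp n) : 0 <= proj_dist R x y.
Proof. by rewrite /proj_dist /vec_dist divr_ge0 ?mulr_ge0 ?bigmax_ge_id. Qed.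

Lemma sup_dist_ge0 n (x y : 'rV[Qp]_n) : 0 <= sup_dist R x y.
Proof. exact: bigmax_ge_id. Qed.

Lemma eq_residue_sub0 (x y : Zp) k : (x - y) k = 0%N <-> x k = y k.
Proof.
split=> [e|]; last exact: residue_sub.
by rewrite -[x](subrK y) residueD e add0n residue_mod.
Qed.

Lemma residue_eqP (x y : Zp) k :
  x k = y k <-> padic_abs R (x%:F - y%:F : Qp) <= pR ^- k.
Proof.
by rewrite -tofracB padic_abs_int -eq_residue_sub0; split=> /eqP.
Qed.

Definition int_vec n (x : 'I_n -> Zp) : 'rV[Qp]_n := \row_i (x i)%:F.

Lemma residues_eqP n (x y : 'I_n -> Zp) k :
  residues k x = residues k y <-> forall i, x i k = y i k.
Proof.
rewrite reduce_eqP; split=> e i; first by have := e i; rewrite !residue_mod.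
by rewrite e.
Qed.

Lemma padic_abs_expN M : padic_abs R ((p%:R : Qp) ^- M) = pR ^+ M.
Proof.
have pM0 : pR ^+ M != 0 by rewrite expf_neq0// pnatr_eq0 -lt0n prime_gt0.
have := padic_absM R ((p%:R : Qp) ^+ M) (p%:R ^- M).
rewrite divff ?expf_neq0 ?Qp_natrp_neq0// padic_abs1 padic_absX padic_abs_p exprVn.
by move=> e; apply: (mulfI (invr_neq0 pM0)); rewrite -e mulVf.
Qed.

Lemma scaled_dist_le n (x y : 'I_n -> Zp) k M : residues k x = residues k y ->
  sup_dist R ((p%:R : Qp) ^- M *: int_vec x) (p%:R ^- M *: int_vec y) <=
  pR ^+ M * pR ^- k.
Proof.
move=> /residues_eqP e; apply: bigmax_le => [|i _].
  by rewrite mulr_ge0 ?invr_ge0 ?exprn_ge0.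
rewrite -scalerBr !mxE padic_absM padic_abs_expN.
by rewrite ler_wpM2l ?exprn_ge0//; apply/residue_eqP.
Qed.

Lemma scaled_residues n (x y : 'I_n -> Zp) k M :
  sup_dist R ((p%:R : Qp) ^- M *: int_vec x) (p%:R ^- M *: int_vec y) <= pR ^- k ->
  residues k x = residues k y.
Proof.
move=> le; apply/residues_eqP => i; apply/residue_eqP; apply: le_trans le.
apply: le_trans (le_bigmax _ _ i).
rewrite -scalerBr !mxE padic_absM padic_abs_expN ler_peMl ?padic_abs_ge0//.
by rewrite exprn_ege1// ler1n prime_gt0.
Qed.

Lemma int_vec_neq0 n (x : 'I_n -> Zp) c : x c = 1 -> int_vec x != 0.
Proof.
move=> xc; apply/eqP => /rowP/(_ c); rewrite !mxE xc tofrac1 => /eqP.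
by rewrite oner_eq0.
Qed.

Lemma sup_norm_int_vec n (x : 'I_n -> Zp) c : x c = 1 ->
  1 <= sup_norm R (int_vec x).
Proof.
move=> xc; apply: le_trans (le_bigmax _ _ c).
by rewrite mxE xc tofrac1 padic_abs1.
Qed.

(** Coordinate [c] makes the norms at least 1, and the minors of two vectors congruent modulo
    [p ^ g] are divisible by [p ^ g]. *)
Lemma vec_dist_le n (x y : 'I_n -> Zp) c g : x c = 1 -> y c = 1 ->
  residues g x = residues g y ->
  vec_dist R (int_vec x) (int_vec y) <= pR ^- g.
Proof.
move=> xc yc /residues_eqP e; rewrite /vec_dist.
have x1 := sup_norm_int_vec xc; have y1 := sup_norm_int_vec yc.
have xy1 : 1 <= sup_norm R (int_vec x) * sup_norm R (int_vec y) by exact: mulr_ege1.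
rewrite ler_pdivrMr ?(lt_le_trans ltr01)//.
have pg0 : 0 <= pR ^- g by rewrite invr_ge0 exprn_ge0.
apply: le_trans (ler_peMr pg0 xy1).
apply: bigmax_le => // i _; apply: bigmax_le => // j _.
by rewrite !mxE -!tofracM; apply/residue_eqP; rewrite !residueM !e mulnC.
Qed.

Lemma eq_proj_point n (u v : 'rV[Qp]_n) (u0 : u != 0) (v0 : v != 0) (a : Qp) :
  u = a *: v -> proj_point u0 = proj_point v0.
Proof.
move=> uv; apply/val_inj => /=; rewrite uv.
apply/eqP; rewrite eqEdim; apply/andP; split.
  by rewrite -memvE memvZ// memv_line.
by rewrite !dim_vline v0 -uv u0.
Qed.

Lemma padic_int_val_pX a : padic_int_val (p%:R ^+ a : Zp) = a.
Proof.
apply: padic_int_val_unique; rewrite -natrX residue_natr ?modnn//.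
by rewrite modn_small ?ltn_exp2l ?prime_gt1// -lt0n expn_gt0 prime_gt0.
Qed.

(** Dividing by a coordinate of largest absolute value makes the direction integral, and a power of
    [p] clears the coefficients. The valuation of [mu] is bounded through [M], so countably many
    pairs [(M, c)] describe all curves. *)
Lemma normalize_curve n d (a : 'I_d.+1 -> 'rV[Qp]_n) (v : 'rV[Qp]_n) (v0 : v != 0) :
  exists M c nu al mu (nu0 : int_vec nu != 0),
  [/\ nu c = 1, mu != 0, (padic_int_val mu <= 2 * M)%N,
     proj_point v0 = proj_point nu0 &
     forall t : Zp, poly_curve a v t%:F =
       p%:R ^- M *: int_vec (int_curve d al mu nu t)].
Proof.
have /existsP[i0 vi0] : [exists i, v 0 i != 0].
  apply: contraNT v0 => /existsPn h; apply/eqP/rowP => i; rewrite mxE.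
  exact/eqP/negPn/h.
have [c _ cmax'] := @arg_maxP _ _ _ i0 xpredT (fun i => padic_abs R (v 0 i)) isT.
have cmax i : padic_abs R (v 0 i) <= padic_abs R (v 0 c) by exact: cmax'.
have vc0 : v 0 c != 0.
  by rewrite -(padic_abs_eq0 R) gt_eqF// (lt_le_trans _ (cmax i0))// padic_abs_gt0.
have /choice[nu nuE] : forall i, exists z : Zp, v 0 i / v 0 c = z%:F.
  move=> i; apply: (@padic_abs_le1 R); rewrite -(ler_pM2r (padic_abs_gt0 R vc0)).
  by rewrite -padic_absM divfK// mul1r cmax.
have nuc : nu c = 1.
  by apply/eqP; rewrite -tofrac_eq -nuE divff// tofrac1.
have /choice[Ma MaP] : forall jc : 'I_d.+1 * 'I_n, exists M, forall m, (M <= m)%N ->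
    exists z : Zp, p%:R ^+ m * a jc.1 0 jc.2 = z%:F.
  by move=> jc; exact: padic_clear.
have [M1 /(_ _ (leqnn _))[mu1 mu1E]] := padic_clear (v 0 c).
have mu10 : mu1 != 0.
  by rewrite -tofrac_eq0 -mu1E mulf_neq0// expf_neq0// Qp_natrp_neq0.
(* Including [padic_int_val mu1] gives [padic_int_val mu = e + padic_int_val mu1 <= 2 * e]. *)
pose e := (padic_int_val mu1 + \max_jc Ma jc)%N.
pose M := (M1 + e)%N.
pose mu : Zp := p%:R ^+ e * mu1.
have pe0 : p%:R ^+ e != 0 :> Zp by rewrite expf_neq0// natrp_neq0.
have pM0 : p%:R ^+ M != 0 :> Qp by rewrite expf_neq0// Qp_natrp_neq0.
have muE : mu%:F = p%:R ^+ M * v 0 c.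
  by rewrite tofracM -mu1E tofrac_X tofrac_natr mulrA -exprD addnC.
have /choice[al0 al0E] : forall jc : 'I_d.+1 * 'I_n, exists z : Zp,
    p%:R ^+ M * a jc.1 0 jc.2 = z%:F.
  move=> jc; apply: MaP; apply: leq_trans (leq_bigmax jc) _.
  by rewrite /M /e addnA leq_addl.
pose al (j : nat) c' := if insub j is Some j' then al0 (j', c') else 0.
exists M, c, nu, al, mu, (int_vec_neq0 nuc); split => //.
- by rewrite mulf_neq0.
- by rewrite padic_int_valM// padic_int_val_pX /M /e; lia.
- apply: (@eq_proj_point _ _ _ _ _ (v 0 c)); apply/rowP => i.
  by rewrite !mxE -nuE mulrC divfK.
- move=> t; apply/rowP => i; rewrite !mxE summxE tofracD tofracM.
  rewrite (big_morph _ (@tofracD Zp) (@tofrac0 Zp)) mulrDr mulr_sumr; congr (_ + _).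
    apply: eq_bigr => j _; rewrite mxE tofracM tofrac_X /al valK -al0E /=.
    by rewrite -mulrA mulKf// mulrC.
  rewrite (tofracM mu) tofrac_X muE.
  have -> : v 0 i = v 0 c * (nu i)%:F by rewrite -nuE mulrC divfK.
  by rewrite -!mulrA mulKf// mulrC -mulrA.
Qed.

End Geometry.

(** Exponents of [p] are compared. Replacing [k] by [h] costs [3 * l] in [D + 2] factors of the
    count and [3 * l * t] in the weight; the last hypothesis pays for this. *)
Lemma weight_bound (R : realType) (p k l L r D N C : nat) (s t : R)
    (h := (k - 3 * l)%N) :
  (1 < p)%N -> (3 * l < k)%N -> (r <= h)%N -> (L <= h)%N ->
  (C * p ^ (h - r) * p ^ (h * D) * p ^ h.-1 <= 2 * (p ^ k * p ^ (k * D) * N))%N ->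
  3 * (D%:R + 2 + t) * l%:R <= k%:R * (1 + t - s) ->
  C%:R * (p%:R ^- (h - L)) `^ t <=
  2 * p%:R ^+ r.+1 * p%:R `^ (L%:R * t) * (N%:R * (p%:R `^ (- s)) ^+ k).
Proof.
move=> p1 lk rh Lh cnt lin.
have pR1 : 1 <= p%:R :> R by rewrite ler1n ltnW.
have pR0 : 0 < p%:R :> R by rewrite (lt_le_trans ltr01).
have pn0 : p%:R != 0 :> R by rewrite gt_eqF.
have pX a : p%:R ^+ a = p%:R `^ a%:R :> R by rewrite powR_mulrn// ltW.
have pD (a b : R) : p%:R `^ a * p%:R `^ b = p%:R `^ (a + b).
  by rewrite powRD// pn0 implybT.
set X := p%:R `^ ((h - r)%:R + (h * D)%:R + h.-1%:R) : R.
have X0 : 0 < X by rewrite powR_gt0.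
have cntR : C%:R * X <= 2 * N%:R * p%:R `^ (k%:R + (k * D)%:R).
  rewrite /X -!pD -!pX !mulrA -!natrX -!natrM ler_nat.
  by rewrite (leq_trans cnt)// -!mulnA leq_mul2l/= mulnA mulnC leqnn.
rewrite -(ler_pM2r X0) mulrAC.
apply: (@le_trans _ _
  (2 * N%:R * p%:R `^ (k%:R + (k * D)%:R) * (p%:R ^- (h - L)) `^ t)).
  by rewrite ler_wpM2r ?powR_ge0.
have -> : (p%:R ^- (h - L)) `^ t = p%:R `^ (- (h - L)%:R * t) :> R.
  by rewrite pX -powRN -powRrM.
have -> : (p%:R `^ (- s)) ^+ k = p%:R `^ (- s * k%:R) :> R.
  by rewrite -powR_mulrn ?powR_ge0// -powRrM.
rewrite /X pX -mulrA pD.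
have -> (a b c e f : R) : 2 * a * b * (c * e) * f = 2 * c * (a * b * e * f) by ring.
rewrite !pD ler_wpM2l ?mulr_ge0// ler_powR//.
have hE : h%:R = k%:R - 3 * l%:R :> R by rewrite /h natrB ?(ltnW lk)// natrM.
have h1E : h.-1%:R = h%:R - 1 :> R.
  by rewrite -subn1 natrB// /h subn_gt0.
rewrite (natrB _ rh) (natrB _ Lh) -(natr1 r) !natrM h1E hE.
move: lin; rewrite !(mulrDr, mulrDl, mulrBr, mulrBl, mulrN, mulNr, opprD, opprB).
lra.
Qed.

(** * Null pieces of the set of directions *)

Section Pieces.
Variables (R : realType) (p : nat) (hp : prime p) (n d : nat).
Local Notation Zp := (padic_int hp).
Local Notation Qp := (padic hp).
Local Notation pR := (p%:R : R).

Definition direction_piece (E : set 'rV[Qp]_n) M c : set (proj_space Qp n) :=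
  [set w | exists nu al mu (nu0 : int_vec nu != 0),
    [/\ nu c = 1, mu != 0, (padic_int_val mu <= 2 * M)%N, w = proj_point nu0 &
     forall t : Zp, E (p%:R ^- M *: int_vec (int_curve d al mu nu t))]].

(** Classes of rich directions at levels [k >= k1] cover the piece, and [weight_bound] compares
    their [t]-weight at level [k] with the [s]-weight of [B k]. *)
Lemma direction_piece_null (E : set 'rV[Qp]_n) M c (s t : R) :
  0 < s -> 0 <= t -> s < t + 1 -> hausdorff_measure (sup_dist R) s E = 0%E ->
  hausdorff_measure (proj_dist R) t (direction_piece E M c) = 0%E.
Proof.
move=> s0 t0 st E0; apply: hausdorff_null => delta delta0 e e0.
have p1 := prime_gt1 hp; have pR0 : 0 < pR by rewrite ltr0n ltnW.
have [g0 g0P] := exists_expV_le hp delta0.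
pose L := (2 * M)%N; pose v := logn p d.+1; pose r := (L + (2 * v).+1)%N.
(* With [l = k %/ q], this gives the last hypothesis of [weight_bound]. *)
have [q [q4 qP]] : exists q, (4 <= q)%N /\
    3 * ((d * n)%:R + 2 + t) <= q%:R * (1 + t - s) :> R.
  have D0 : 0 < 1 + t - s by rewrite subr_gt0 addrC.
  have A0 : 0 <= 3 * ((d * n)%:R + 2 + t) / (1 + t - s).
    by rewrite divr_ge0 ?(ltW D0)// mulr_ge0// !addr_ge0.
  exists (4 + Num.bound (3 * ((d * n)%:R + 2 + t) / (1 + t - s)))%N.
  split; first exact: leq_addr.
  by rewrite -ler_pdivrMr// natrD (le_trans (ltW (archi_boundP A0)))// lerDr.
(* From [k1] on, [h >= r + g0 + L]; hence [g = h - L] is at least [g0], and the diameters are at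
   most [delta]. *)
have [k1 k1P] := level_params n d (r + g0 + L) p1 q4.
set cst : R := 2 * pR ^+ r.+1 * pR `^ (L%:R * t).
have cst0 : 0 < cst by rewrite !mulr_gt0 ?powR_gt0 ?exprn_gt0.
have ec0 : 0 < e / cst by rewrite divr_gt0.
have [B [B0 Bsum Bcov]] := null_levels (psi := fun x => p%:R ^- M *: int_vec x)
  (@sup_dist_ge0 R p hp n) (fun x y k => @scaled_residues R p hp n x y k M)
  s0 E0 k1 ec0.
pose l k := (k %/ q)%N; pose h k := (k - 3 * l k)%N; pose m k := (k - l k)%N.
pose g k := (h k - L)%N.
pose N k := (((d.+1 * n) * (h k * p ^ h k) + p ^ h k) * p ^ (k - m k))%N.
pose P k := rich (hp := hp) d c L (N k) (B k).
pose U k (a : {ffun 'I_n -> 'I_(p ^ g k)}) : set (proj_space Qp n) :=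
  [set w | (k1 <= k)%N /\ exists nu (nu0 : int_vec nu != 0),
     [/\ P k nu, w = proj_point nu0 & a = residues (g k) nu]].
have Udiam k a : (k1 <= k)%N ->
    (diameter (proj_dist R) (U k a) <= (pR ^- g k)%:E)%E.
  move=> kk; apply: ge_ereal_sup => _ [x [y [Ux Uy ->]]].
  move: Ux Uy => [_ [nu [nu0 [Pnu -> aE]]]] [_ [nu' [nu'0 [Pnu' -> aE']]]].
  rewrite lee_fin proj_dist_point; apply: (@vec_dist_le R p hp n nu nu' c).
  - by case: Pnu.
  - by case: Pnu'.
  - by rewrite -aE.
have cover w : direction_piece E M c w -> exists k a, U k a w.
  move=> [nu [al [mu [nu0 [nuc mu0 muL -> Et]]]]].
  have [k kP] := @exists_rich_level R p hp n d B al mu nu (fun x => Bcov _ (Et x)).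
  (* [B k] is empty below [k1], so nothing is hit there. *)
  have kk : (k1 <= k)%N.
    rewrite leqNgt; apply/negP => kk.
    have hE : #|hits d (B k) al mu nu| = 0%N.
      by apply: eq_card0 => x; rewrite inE B0// finset.in_set0.
    by move: kP; rewrite hE mul0n leqNgt pexp_gt0.
  exists k, (residues (g k) nu); split => //; exists nu, nu0; split => //.
  split => //; exists al, mu; split => //.
  have [_ _ _ h4] := k1P k kk.
  by have := leq_trans h4 kP; rewrite leq_mul2r.
pose w k : R := cst * (#|B k|%:R * (pR `^ (- s)) ^+ k).
have w0 k : 0 <= w k.
  by rewrite mulr_ge0 ?(ltW cst0)// mulr_ge0// exprn_ge0// powR_ge0.
apply: le_trans (premeasure_levels (U := U) (c := w) cover _ _) _.
- move=> k a; have [kk|kk] := leqP k1 k.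
    apply: le_trans (Udiam k a kk) _; rewrite lee_fin; apply: le_trans g0P.
    rewrite lef_pV2 ?posrE ?exprn_gt0// ler_eXn2l ?ltr1n//.
    have [_ + _ _] := k1P k kk; rewrite -/(l k) -/(h k) => hk.
    rewrite /g leq_subRL ?(leq_trans _ hk) ?leq_addl//.
    by rewrite addnC -addnA leq_addl.
  rewrite (_ : U k a = set0) ?diameter0 ?leNye//.
  by apply/seteqP; split => // x [+ _]; rewrite leqNgt kk.
- move=> k; have [kk|kk] := leqP k1 k; last first.
    rewrite big1 ?lee_fin// => a _; rewrite /diameter_pow ifT//; apply/eqP.
    by apply/seteqP; split => // x [+ _]; rewrite leqNgt kk.
  have [h1 h2 h3 _] := k1P k kk; rewrite -/(l k) -/(h k) -/(m k) in h1 h2 h3.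
  pose C := [set a : {ffun 'I_n -> 'I_(p ^ g k)} |
     `[< exists2 nu, P k nu & a = residues (g k) nu >] ]%SET.
  have cnt : (#|C| * p ^ (h k - r) * p ^ (h k * (d * n)) * p ^ (h k).-1 <=
      2 * (p ^ k * p ^ (k * (d * n)) * #|B k|))%N.
    apply: class_count => //; [exact: leq_subr| |exact: leq_subr].
    by rewrite (leq_trans _ h2)// -addnA leq_addr.
  apply: (@le_trans _ _ (\sum_(a in C) ((pR ^- g k) `^ t)%:E)%E).
    rewrite [leRHS]big_mkcond; apply: lee_sum => a _; case: ifPn => aC.
      apply: diameter_pow_le (Udiam k a kk) => //; exact: proj_dist_ge0.
    rewrite /diameter_pow ifT//; apply/eqP/seteqP; split => // x.
    move=> [_ [nu [nu0 [Pnu _ aE]]]]; move/negP: aC; apply; rewrite inE.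
    by apply/asboolP; exists nu.
  rewrite sumEFin sumr_const lee_fin -[leLHS]mulr_natl /w /g.
  apply: (weight_bound (D := (d * n)%N)) => //.
  + by rewrite -subn_gt0.
  + by rewrite (leq_trans _ h2)// -addnA leq_addr.
  + by rewrite (leq_trans _ h2)// leq_addl.
  + have lk : (q * l k <= k)%N by rewrite mulnC leq_divM.
    apply: (@le_trans _ _ (q%:R * (1 + t - s) * (l k)%:R)).
      by rewrite ler_wpM2r.
    rewrite mulrAC ler_wpM2r ?subr_ge0 ?(ltW st)//; last by rewrite -natrM ler_nat.
    by rewrite addrC ltW.
apply: lime_le; first by apply: is_cvg_nneseries => k _ _; rewrite lee_fin.
apply: nearW => K; rewrite sumEFin lee_fin big_mkord -mulr_sumr.
by rewrite mulrC -ler_pdivlMr//; exact: Bsum.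
Qed.

End Pieces.

(** * Comparison of dimensions *)

Section Dimension.
Variables (R : realType) (p : nat) (hp : prime p).
Local Notation Zp := (padic_int hp).
Local Notation Qp := (padic hp).
Local Notation pR := (p%:R : R).

(** If [E] is null in exponent [s], then [V], contained in a countable union of pieces, is null in
    every exponent [t >= 0] with [t > s - 1]. *)
Lemma dim_directions_le n d (V : set (proj_space Qp n)) (E : set 'rV[Qp]_n) :
  (0 < n)%N -> V !=set0 ->
  (forall w, V w -> exists (a : 'I_d.+1 -> 'rV[Qp]_n) (v : 'rV[Qp]_n) (v0 : v != 0),
     proj_point v0 = w /\ forall z : Zp, E (poly_curve a v z%:F)) ->
  (hausdorff_dim (proj_dist R) V + 1 <= hausdorff_dim (sup_dist R) E)%E.
Proof.
move=> n0 [w0 Vw0] VE; apply: le_hausdorff_dim => s s0 Es.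
have Ene : E !=set0.
  by have [a [v [v0 [_ Ez]]]] := VE _ Vw0; exists (poly_curve a v (0 : Zp)%:F).
have {}s0 : 0 < s.
  rewrite lt_neqAle s0 andbT; apply/negP => /eqP s00.
  by have /negP := hausdorff0_neq0 (sup_dist R) Ene; rewrite s00 Es.
have VM t : 0 <= t -> s < t + 1 -> hausdorff_measure (proj_dist R) t V = 0%E.
  move=> t0 st; pose piece j := direction_piece d E (j %/ n) (Ordinal (ltn_pmod j n0)).
  apply: (@sub_null _ _ _ _ _ (\bigcup_j piece j)); last first.
    by apply: null_bigcup => j; exact: direction_piece_null Es.
  move=> w /VE[a [v [v0 [<- Et]]]].
  have [M [c [nu [al [mu [nu0 [nuc mu0 muM -> curveE]]]]]]] := normalize_curve R a v0.
  exists (M * n + c)%N => //.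
  have -> : piece (M * n + c)%N = direction_piece d E M c.
    rewrite /piece divnMDl// divn_small// addn0; congr direction_piece.
    by apply/val_inj; rewrite /= modnMDl modn_small.
  by exists nu, al, mu, nu0; split => // t'; rewrite -curveE.
(* If [s < 1], then [t = 0] is allowed, but no nonempty set is null in exponent 0. *)
have s1 : 1 <= s.
  rewrite leNgt; apply/negP => s1.
  have Vne : V !=set0 by exists w0.
  by have /negP := hausdorff0_neq0 (proj_dist R) Vne; rewrite VM ?add0r.
apply/lee_addgt0Pr => e e0.
have t0 : 0 <= s - 1 + e by rewrite addr_ge0 ?subr_ge0// ltW.
have st : s < s - 1 + e + 1 by rewrite addrAC subrK ltrDl.
apply: (@le_trans _ _ ((s - 1 + e)%:E + 1)%E).
  by rewrite leeD2r// hausdorff_dim_le// VM.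
by rewrite -EFinD addrAC subrK.
Qed.

(** The space is the union of the [p ^- M] multiples of the integral vectors. Each multiple is
    covered by [p ^ (k * n)] classes, of total weight at most [p ^ (M * s) * p ^ (- k * e)] in
    exponent [s = n + e]. *)
Lemma dim_le n (E : set 'rV[Qp]_n) : (hausdorff_dim (sup_dist R) E <= n%:R%:E)%E.
Proof.
have pR0 : 0 < pR by rewrite ltr0n prime_gt0.
apply/lee_addgt0Pr => e e0; rewrite -EFinD.
apply: hausdorff_dim_le; first by rewrite addr_ge0// ltW.
set s := n%:R + e; have s0 : 0 <= s by rewrite addr_ge0// ltW.
pose A M := [set u | exists x : 'I_n -> Zp, u = (p%:R : Qp) ^- M *: int_vec x].
apply: (@sub_null _ _ _ _ _ (\bigcup_M A M)).
  move=> u _.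
  have /choice[Ma MaP] : forall i, exists M, forall m, (M <= m)%N ->
      exists z : Zp, p%:R ^+ m * u 0 i = z%:F by move=> i; exact: padic_clear.
  have /choice[x xE] : forall i, exists z : Zp, p%:R ^+ (\max_i Ma i) * u 0 i = z%:F.
    by move=> i; apply: MaP; exact: leq_bigmax.
  exists (\max_i Ma i)%N => //; exists x; apply/rowP => i; rewrite !mxE -xE mulKf//.
  by rewrite expf_neq0// Qp_natrp_neq0.
apply: null_bigcup => M; apply: hausdorff_null => delta delta0 e' e'0.
(* The first bound controls the diameters, the second the total weight. *)
pose y := Num.min (delta / pR ^+ M) ((e' / (pR ^+ M) `^ s) `^ e^-1).
have pM0 : 0 < pR ^+ M by rewrite exprn_gt0.
have y0 : 0 < y by rewrite lt_min divr_gt0//= powR_gt0// divr_gt0// powR_gt0.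
have [k] := exists_expV_le hp y0; rewrite le_min => /andP[k1 k2].
have pV0 : 0 <= pR ^- k by rewrite invr_ge0 exprn_ge0// ltW.
pose U (a : {ffun 'I_n -> 'I_(p ^ k)}) :=
  [set u | exists2 x : 'I_n -> Zp,
     u = (p%:R : Qp) ^- M *: int_vec x & residues k x = a].
have Ud a : (diameter (sup_dist R) (U a) <= (pR ^+ M * pR ^- k)%:E)%E.
  apply: ge_ereal_sup => _ [u [v [Uu Uv ->]]].
  move: Uu Uv => [x -> xa] [x' -> xa']; rewrite lee_fin.
  by apply: scaled_dist_le; rewrite xa.
apply: le_trans (premeasure_fin (U := U) _ _ _) _.
- by move=> u [x ->]; exists (residues k x) => //; exists x.
- move=> a; apply: le_trans (Ud a) _; rewrite lee_fin mulrC -ler_pdivlMr//.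
apply: (@le_trans _ _
  (\sum_(a : {ffun 'I_n -> 'I_(p ^ k)}) ((pR ^+ M * pR ^- k) `^ s)%:E)%E).
  apply: lee_sum => a _; apply: diameter_pow_le (Ud a) => //.
  exact: sup_dist_ge0.
rewrite sumEFin lee_fin sumr_const card_ffun !card_ord -[leLHS]mulr_natl.
rewrite powRM ?(ltW pM0)//.
rewrite [leLHS](_ : _ = (pR ^+ M) `^ s * (pR ^- k) `^ e); last first.
  have pX a : pR ^+ a = pR `^ a%:R by rewrite powR_mulrn// ltW.
  have -> : pR ^- k = pR `^ (- k%:R) by rewrite powRN -pX.
  rewrite -expnM natrX (pX (k * n)%N) mulrCA; congr (_ * _).
  have pD (a b : R) : pR `^ a * pR `^ b = pR `^ (a + b).
    by rewrite powRD// (gt_eqF pR0) implybT.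
  rewrite -!powRrM pD; congr (_ `^ _).
  by rewrite natrM /s; ring.
rewrite mulrC -ler_pdivlMr ?powR_gt0//.
have y20 : 0 < e' / (pR ^+ M) `^ s by rewrite divr_gt0// powR_gt0.
have := ge0_ler_powR (ltW e0) _ _ k2; rewrite -powRrM mulVf ?gt_eqF//.
rewrite (powRr1 (ltW y20)); apply; rewrite nnegrE//.
by rewrite powR_ge0.
Qed.

(** On the points [[1 : x]] with [x] integral, the minors with coordinate 0 bound the distance
    below. A null exponent [t < n] would cover all [x] by classes of total proportion at most
    [1 / 2], against [exists_uncovered]. *)
Lemma le_dim_proj_space n :
  (n%:R%:E <= hausdorff_dim (proj_dist R) [set: proj_space Qp n.+1])%E.
Proof.
pose f (x : 'I_n -> Zp) (i : 'I_n.+1) : Zp :=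
  if unlift ord0 i is Some j then x j else 1.
have f0 x : f x ord0 = 1 by rewrite /f unlift_none.
have fl x j : f x (lift ord0 j) = x j by rewrite /f liftK.
pose psi x := proj_point (int_vec_neq0 (f0 x)).
apply: le_hausdorff_dim => t t0 H0.
have {}t0 : 0 < t.
  rewrite lt_neqAle t0 andbT; apply/negP => /eqP t00.
  have ne : [set: proj_space Qp n.+1] !=set0 by exists (psi (fun=> 0)).
  by have /negP := hausdorff0_neq0 (proj_dist R) ne; rewrite t00 H0.
rewrite lee_fin leNgt; apply/negP => tn.
have norm1 x : sup_norm R (int_vec (f x)) = 1.
  apply/eqP; rewrite eq_le (sup_norm_int_vec R (f0 x)) andbT.
  apply: bigmax_le => // i _; rewrite mxE.
  by have := padic_abs_int R (f x i) 0; rewrite expr0 invr1 residue_nat0 eqxx.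
have psi_res x y k :
    proj_dist R (psi x) (psi y) <= pR ^- k -> residues k x = residues k y.
  rewrite proj_dist_point /vec_dist !norm1 mulr1 divr1 => le.
  apply/residues_eqP => j; apply/(residue_eqP R); apply: le_trans le.
  apply: le_trans (le_bigmax _ _ (lift ord0 j)); apply: le_trans (le_bigmax _ _ ord0).
  by rewrite !mxE !f0 !fl tofrac1 mulr1 mul1r.
have half0 : 0 < 2^-1 :> R by rewrite invr_gt0.
have [B [_ Bsum Bcov]] :=
  null_levels (@proj_dist_ge0 R p hp n.+1) psi_res t0 H0 0%N half0.
have [K|x xP] := @exists_uncovered p hp n R B.
  apply: le_lt_trans (_ : 2^-1 < 1); last by lra.
  apply: le_trans (Bsum K); apply: ler_sum => k _.
  have pX a : pR ^+ a = pR `^ a%:R by rewrite powR_mulrn.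
  rewrite ler_wpM2l// powRN_exprn// !pX -!powRN -powRrM ler_powR ?ler1n ?prime_gt0//.
  by rewrite mulNr lerN2 natrM mulrC ler_wpM2r// ltW.
by have [k] := Bcov x I; rewrite (negbTE (xP k)).
Qed.

End Dimension.

Theorem theorem1p1 (R : realType) (p : nat) (hp : prime p) (n d : nat)
    (hn : (1 <= n)%N) (hd : (1 <= d)%N)
    (V : set (proj_space (padic hp) n)) (E : set 'rV[padic hp]_n)
    (V_nonempty : V !=set0)
    (hVE : forall w, V w ->
       exists (a : 'I_d -> 'rV[padic hp]_n) (v : 'rV[padic hp]_n) (v0 : v != 0),
         proj_point v0 = w /\
         forall z : padic_int hp, E (poly_curve a v z%:F)) :
  (hausdorff_dim (proj_dist R) V + 1 <= hausdorff_dim (sup_dist R) E)%E /\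
  (V = setT -> hausdorff_dim (sup_dist R) E = n%:R%:E).
Proof.
case: d hd hVE => // d _ hVE; case: n hn V E V_nonempty hVE => // n n0 V E V0 VE.
have dimV := dim_directions_le R n0 V0 VE; split => // VT.
apply/eqP; rewrite eq_le dim_le/=; apply: le_trans dimV.
by rewrite -natr1 EFinD leeD2r// VT le_dim_proj_space.
Qed.
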